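(* Let $A\in\mathbb{R}^{n\times n}$ and $B\in\mathbb{R}^{n\times m}$ with $(A,B)$ controllable, let $Q\in\mathbb{R}^{n\times n}$ and $R\in\mathbb{R}^{m\times m}$ be symmetric positive definite, and let $J$ be the associated continuous-time LQR cost on $\mathcal{G}=\{K\in\mathbb{R}^{m\times n} : A-BK \text{ is Hurwitz}\}$ with minimizer $K^*$. Then there is no $\mu>0$ such that $$\|\nabla J(K)\|\ge\sqrt{\mu\,(J(K)-J(K^* ))}\qquad\text{for all } K\in\mathcal{G};$$ that is, $J$ never satisfies a global Polyak-Łojasiewicz inequality.
   Context: For $K\in\mathcal{G}$ let $P_K$ be the unique solution of the Lyapunov equation $$P_K(A-BK)+(A-BK)^\top P_K+K^\top RK+Q=0,$$ and define $J(K)=\operatorname{trace}(P_K)$. Let $K^*\in\mathcal{G}$ be the (unique) minimizer of $J$ over $\mathcal{G}$. The gradient of $J$ (with respect to the Frobenius inner product) is $\nabla J(K)=-2(B^\top P_K-RK)Y_K$, where $Y_K$ is the unique positive definite solution of $Y_K(A-BK)^\top+(A-BK)Y_K+I=0$. The norm $\|\cdot\|$ is the Frobenius norm. *)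

(* Defs.v *)
From HB Require Import structures.
From mathcomp Require Import all_boot all_order all_algebra.
From mathcomp Require Import all_classical all_reals all_analysis.
From mathcomp Require Import complex.
Import Order.TTheory GRing.Theory Num.Theory.
Import numFieldNormedType.Exports.

Set Implicit Arguments.
Unset Strict Implicit.
Unset Printing Implicit Defensive.

Local Open Scope classical_set_scope.
Local Open Scope ring_scope.

Definition hurwitz (R : realType) (n : nat) (M : 'M[R]_n) : Prop :=
  forall z : R[i], eigenvalue (map_mx (real_complex R) M) z -> complex.Re z < 0.

(* The Kalman matrix [B, AB, ..., A^(n-1) B] has full rank. *)
Definition controllable (R : realType) (n m : nat)
    (A : 'M[R]_n) (B : 'M[R]_(n, m)) : Prop :=
  \rank (\mxrow_(k < n) (A ^+ k *m B)) = n.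

Definition sym_posdef (R : realType) (n : nat) (M : 'M[R]_n) : Prop :=
  M^T = M /\ forall x : 'cV[R]_n, x != 0 -> 0 < (x^T *m M *m x) 0 0.

(* The library norm `|M| on matrices is the max norm, hence this one. *)
Definition frobenius_norm (R : realType) (m n : nat) (M : 'M[R]_(m, n)) : R :=
  Num.sqrt (\sum_i \sum_j M i j ^+ 2).

Definition stabilizing (R : realType) (n m : nat)
    (A : 'M[R]_n) (B : 'M[R]_(n, m)) : set 'M[R]_(m, n) :=
  [set K | hurwitz (A - B *m K)].

Section LQR.
Variables (R : realType) (n m : nat).
Variables (A : 'M[R]_n) (B : 'M[R]_(n, m)) (Q : 'M[R]_n) (S : 'M[R]_m).

(* S is the input weight (the letter R being taken by the real numbers). *)
Definition lyapunov_eq (K : 'M[R]_(m, n)) (P : 'M[R]_n) : Prop :=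
  P *m (A - B *m K) + (A - B *m K)^T *m P + K^T *m S *m K + Q = 0.

(* The solution of the Lyapunov equation is unique when K is stabilizing; for
   other gains [get] may return an arbitrary matrix. *)
Definition lyapunov_sol (K : 'M[R]_(m, n)) : 'M[R]_n :=
  get [set P | lyapunov_eq K P].

(* Only meaningful on [stabilizing A B], which is open, so that the
   differential of lqr_cost at a stabilizing gain depends only on the values
   there. *)
Definition lqr_cost (K : 'M[R]_(m, n)) : R := \tr (lyapunov_sol K).

End LQR.

(* The representative of the Frechet differential of J at K with respect to the
   Frobenius inner product <G, H> = \tr (G^T *m H), see gradientP. *)
Definition gradient (R : realType) (m n : nat) (J : 'M[R]_(m, n) -> R)
    (K : 'M[R]_(m, n)) : 'M[R]_(m, n) :=
  \matrix_(i, j) 'd J K (delta_mx i j).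

Lemma gradientP (R : realType) (m n : nat) (J : 'M[R]_(m, n) -> R)
    (K H : 'M[R]_(m, n)) :
  \tr ((gradient J K)^T *m H) = 'd J K H.
Proof.
rewrite [in RHS](matrix_sum_delta H) linear_sum.
transitivity (\sum_i \sum_j 'd J K (H i j *: delta_mx i j)); last first.
  by apply: eq_bigr => i _; rewrite linear_sum.
rewrite exchange_big /=; apply: eq_bigr => j _.
by rewrite mxE; apply: eq_bigr => i _; rewrite linearZ !mxE /= mulrC.
Qed.

(* Main.v *)
From HB Require Import structures.
Require Import Defs.
From mathcomp Require Import all_boot all_order all_algebra.
From mathcomp Require Import all_classical all_reals all_analysis.
From mathcomp Require Import complex ring lra.
Import Order.TTheory GRing.Theory Num.Theory.
Import numFieldNormedType.Exports.

(** The obstruction is one of growth: a Polyak-Lojasiewicz inequality forces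
    the cost J to grow quadratically in the distance to its minimizers, whereas
    along a suitable high-gain ray of stabilizing gains it grows only linearly.

    Linear growth.  Let P be the solution of the Lyapunov equation at Kstar and
    put K_t = Kstar + t B^T P.  For t >= 0 the matrix P stays a Lyapunov
    function of A - B K_t, because the feedback t B^T P adds the negative
    semidefinite term - 2 t P B B^T P to the Lyapunov equation ([lyap_ray]).
    That term dominates the growth t^2 P B S B^T P of the input cost up to a
    factor O(t), so comparison of Lyapunov equations gives J(K_t) = O(t)
    ([ray_cost]), while the distance from K_t to Kstar is b t with b > 0
    ([ray_dist]; b > 0 is where controllability enters, through B <> 0).

    Consequence of the inequality.  Instead of the gradient flow, one step of
    the proximal point method is used.  Starting from a stabilizing K0, let K1
    minimize J(K) + l |K - K0|^2 over the stabilizing gains.  Such a K1 exists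
    because the pairs (K, P) of a gain and a positive semidefinite solution of
    its Lyapunov equation with trace at most J(K0) form a compact set:
    boundedness is the coercivity estimate |K| <= 1 + c J(K), and the limit of
    such pairs is again one, since a positive semidefinite solution certifies
    stability ([feasible_stabilizing]).  Stationarity gives
    grad J(K1) = - 2 l (K1 - K0), so the inequality yields
    mu (J(K1) - J(Kstar)) <= 4 l^2 |K1 - K0|^2 <= 4 l J(K0).

    With K0 = K_t and l of order t^(-1/2) this gives J(K1) = O(t^(1/2)), hence
    |K1| = O(t^(1/2)) by coercivity, and |K1 - K0| = O(t^(3/4)).  Then
    b t <= |K_t - K1| + |K1| + |Kstar| = O(t^(3/4)), which is absurd for large t.

    The facts about Lyapunov equations needed on the way are that X M + M^T X
    determines X when M is Hurwitz ([lyap_inj]), that X is positive definite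
    when X M + M^T X is negative definite ([lyap_posdef]), and conversely
    that such an X certifies that M is Hurwitz ([hurwitz_certificate]). *)

Set Implicit Arguments.
Unset Strict Implicit.
Unset Printing Implicit Defensive.

Local Open Scope classical_set_scope.
Local Open Scope ring_scope.

(** * Positivity of the Lyapunov equation over an algebraically closed field *)

Lemma mul11mx (T : pzRingType) n (x : 'M[T]_1) (v : 'rV[T]_n) :
  x *m v = x 0 0 *: v.
Proof. by rewrite [in LHS](mx11_scalar x) mul_scalar_mx. Qed.

Section ComplexLyapunov.
Local Open Scope sesquilinear_scope.
Variable C : numClosedFieldType.

Lemma trmxC_mul m n p (A : 'M[C]_(m, n)) (B : 'M[C]_(n, p)) :
  (A *m B)^t* = B^t* *m A^t*.
Proof. by rewrite trmx_mul map_mxM. Qed.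

(** Induction on the dimension by deflating an eigenvector v of M.  Testing the
    inequality on v gives 2 Re(a) (v X v^* ) < 0, hence v X v^* > 0, and C^n
    splits X-orthogonally into the line of v and the space W of the w with
    w X v^* = 0.  Since W is X-orthogonal to v, the compression MW of M to W
    along v satisfies the same Lyapunov inequality for the restriction of X,
    and its eigenvalues are eigenvalues of M. *)
Lemma lyapunov_hermitian_pos n (M X : 'M[C]_n) :
  X^t* = X -> (forall a, eigenvalue M a -> 'Re a < 0) ->
  (forall v : 'rV_n, v != 0 ->
     (v *m (M *m X + X *m M^t*) *m v^t*) 0 0 < 0) ->
  forall v : 'rV_n, v != 0 -> 0 < (v *m X *m v^t*) 0 0.
Proof.
have [k] := ubnP n; elim: k n M X => // k IHk n M X ltnk Xh Meig Mneg.
move=> u u0.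
have n_gt0 : (0 < n)%N.
  by case: (posnP n) u0 => // n0; move: u; rewrite n0 => u; rewrite thinmx0 eqxx.
have [a aM] := eigenvalue_closed M n_gt0.
have /eigenvalueP[v vM v0] := aM.
set x := (v *m X *m v^t*) 0 0.
have xE : v *m X *m v^t* = x%:M by rewrite [LHS]mx11_scalar.
have x_gt0 : 0 < x.
  have := Mneg _ v0; rewrite mulmxDr mulmxDl mulmxA vM !mulmxA -scalemxAl.
  rewrite -[v *m X *m M^t* *m v^t*]mulmxA -trmxC_mul vM.
  rewrite linearZ /= map_mxZ -scalemxAl -scalemxAr xE mxE !mxE eqxx !mulr1n.
  rewrite -mulrDl mulrC => xlt.
  have : x * ('Re a *+ 2) < 0.
    rewrite ReE; set y := _ + _ in xlt *; have -> // : y / 2 *+ 2 = y.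
    by rewrite -mulr_natr divfK // pnatr_eq0.
  rewrite mulrC nmulr_rlt0 //.
  by rewrite pmulrn_llt0 // Meig.
have vXv_neq0 : x != 0 by rewrite gt_eqF.
pose W := row_base (kermx (X *m v^t*)).
have WXv : W *m X *m v^t* = 0.
  by apply/eqP; rewrite -mulmxA -sub_kermx eq_row_base.
have vXW : v *m X *m W^t* = 0.
  have : (W *m X *m v^t*)^t* = 0 by rewrite WXv trmx0 map_mx0.
  by rewrite trmxC_mul trmxCK trmxC_mul Xh mulmxA.
have Wsub m (w : 'M[C]_(m, n)) : w *m X *m v^t* = 0 -> (w <= W)%MS.
  by move=> w0; rewrite eq_row_base sub_kermx mulmxA w0.
have Wfree y : y *m W = 0 -> y = 0.
  by move=> /eqP; rewrite mulmx_free_eq0 ?row_base_free // => /eqP.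
clearbody W.
pose c := x^-1 *: (W *m M *m X *m v^t*).
pose MW := (W *m M - c *m v) *m pinvmx W.
have WM : W *m M = c *m v + MW *m W.
  rewrite mulmxKpV ?subrKC //; apply: Wsub.
  rewrite !mulmxBl -[X in _ - X]mulmxA -[X in _ - X]mulmxA [v *m _]mulmxA xE.
  by rewrite mul_mx_scalar /c scalerA divff // scale1r subrr.
clearbody MW c.
have rk : (\rank (kermx (X *m v^t*)) < k)%N.
  rewrite -ltnS (leq_trans _ ltnk) // ltnS.
  rewrite mxrank_ker -subn_gt0 subKn ?rank_leq_row // lt0n mxrank_eq0.
  by apply: contra vXv_neq0 => /eqP Xv0; rewrite /x -mulmxA Xv0 mulmx0 mxE.
have {IHk} IH := IHk _ MW (W *m X *m W^t*) rk.
have XWh : (W *m X *m W^t*)^t* = W *m X *m W^t*.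
  by rewrite !trmxC_mul trmxCK Xh mulmxA.
have MWeig b : eigenvalue MW b -> 'Re b < 0.
  have [->|ba] := eqVneq b a; first by move=> _; exact: Meig.
  move=> /eigenvalueP[y yMW y0]; apply: Meig; apply/eigenvalueP.
  pose t := (y *m c) 0 0 / (b - a).
  (* An eigenvector y of the compression lifts to y W + t v; as a differs from
     b, the coefficient t can absorb the component of y W M along v. *)
  exists (y *m W + t *: v).
    have -> : (y *m W + t *: v) *m M =
        (y *m c) 0 0 *: v + b *: (y *m W) + t *: (a *: v).
      rewrite mulmxDl -mulmxA WM mulmxDr !mulmxA yMW mul11mx -!scalemxAl.
      by rewrite vM.
    rewrite addrAC addrC scalerDr; congr (_ + _).
    rewrite !scalerA -scalerDl; congr (_ *: _); rewrite /t.
    by field; rewrite subr_eq0.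
  apply: contra y0 => /eqP u00.
  have t0 : t = 0.
    have := congr1 (fun z => (z *m X *m v^t*) 0 0) u00.
    rewrite /= !mulmxDl -[y *m W *m X]mulmxA -[_ *m (W *m X) *m _]mulmxA WXv.
    rewrite mulmx0 add0r -!scalemxAl xE !mul0mx !mxE eqxx mulr1n => /eqP.
    by rewrite mulf_eq0 (negbTE vXv_neq0) orbF => /eqP.
  by rewrite t0 scale0r addr0 in u00; rewrite (Wfree _ _ u00).
have MWneg (y : 'rV_(\rank (kermx (X *m v^t*)))) : y != 0 ->
   (y *m (MW *m (W *m X *m W^t*) + (W *m X *m W^t*) *m MW^t*) *m y^t*) 0 0 < 0.
  move=> y0; have yW0 : y *m W != 0 by apply: contra y0 => /eqP/Wfree ->.
  have := Mneg _ yW0.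
  suff -> : y *m W *m (M *m X + X *m M^t*) *m (y *m W)^t* =
    y *m (MW *m (W *m X *m W^t*) + (W *m X *m W^t*) *m MW^t*) *m y^t* by [].
  have E : MW *m (W *m X *m W^t*) = W *m M *m X *m W^t*.
    rewrite WM !mulmxDl !mulmxA -[c *m v *m X]mulmxA -[c *m _ *m _]mulmxA.
    by rewrite vXW mulmx0 add0r.
  have E' : W *m X *m W^t* *m MW^t* = W *m X *m M^t* *m W^t*.
    have := congr1 (fun Z => Z^t*) E; rewrite /= !trmxC_mul trmxCK Xh !mulmxA.
    by [].
  rewrite E E' trmxC_mul mulmxDr !mulmxDl !mulmxDr !mulmxDl.
  by rewrite !mulmxA.
set t := x^-1 * (u *m X *m v^t*) 0 0.
have /submxP[y wy] : (u - t *: v <= W)%MS.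
  apply: Wsub; rewrite !mulmxBl -!scalemxAl xE.
  rewrite [u *m X *m _]mx11_scalar scale_scalar_mx /t mulrAC mulVf // mul1r.
  by rewrite subrr.
have uE : u = y *m W + t *: v by rewrite -wy subrK.
have -> : (u *m X *m u^t*) 0 0 = (y *m (W *m X *m W^t*) *m y^t*) 0 0 + t * t^* * x.
  rewrite uE linearD linearZ /= map_mxD map_mxZ trmxC_mul.
  rewrite !mulmxDl !mulmxDr -!scalemxAr -!scalemxAl xE.
  rewrite -[y *m W *m X *m v^t*]mulmxA -[y *m W *m _]mulmxA [W *m (_ *m _)]mulmxA.
  rewrite WXv mulmx0 scaler0 addr0 [v *m X *m (_ *m _)]mulmxA vXW mul0mx scaler0.
  rewrite add0r !mulmxA mxE; congr (_ + _).
  by rewrite !mxE eqxx mulr1n mulrA [t * _]mulrC.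
have [y0|y0] := eqVneq y 0.
  rewrite y0 !mul0mx mxE add0r mulr_gt0 // -normCK exprn_gt0 // normr_gt0.
  by apply: contra u0 => /eqP t0; rewrite uE y0 t0 mul0mx scale0r addr0.
by rewrite ltr_wpDr ?IH // mulr_ge0 ?(ltW x_gt0) // -normCK exprn_ge0.
Qed.

(** If X A = B X then X (A - z) = (B - z) X for every z.  By Cayley-Hamilton the
    product of the A - z over the roots z of the characteristic polynomial of A
    vanishes, whereas each B - z is invertible: stripping the factors one at a
    time leaves X = 0. *)
Lemma sylvester_inj m n (A : 'M[C]_n) (B : 'M[C]_m) (X : 'M[C]_(m, n)) :
  X *m A = B *m X ->
  (forall a, eigenvalue A a -> ~~ eigenvalue B a) -> X = 0.
Proof.
case: n A X => [|n] A X XA AB; first by rewrite thinmx0.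
have [r rE] := closed_field_poly_normal (char_poly A).
rewrite (monicP (char_poly_monic A)) scale1r in rE.
have rB z : z \in r -> ~~ eigenvalue B z.
  by move=> zr; apply: AB; rewrite eigenvalue_root_char rE root_prod_XsubC.
have XPr s : {subset s <= r} ->
    X *m horner_mx A (\prod_(z <- s) ('X - z%:P)) = 0 -> X = 0.
  elim: s => [|z s IHs] sr; first by rewrite big_nil rmorph1 mulmx1.
  rewrite big_cons rmorphM /= rmorphB /= horner_mx_X horner_mx_C.
  rewrite -mulmxE mulmxA mulmxBr XA mul_mx_scalar -mul_scalar_mx -mulmxBl.
  rewrite -mulmxA.
  have : row_free (B - z%:M).
    rewrite -kermx_eq0; have := rB z (sr z (mem_head _ _)).
    by rewrite /eigenvalue negbK.
  rewrite row_free_unit => Bu /(congr1 (mulmx (invmx (B - z%:M)))).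
  rewrite mulKmx // mulmx0; apply: IHs => y ys.
  by apply: sr; rewrite inE ys orbT.
apply: (XPr r) => //; rewrite -rE; have := Cayley_Hamilton A => ->.
by rewrite mulmx0.
Qed.
End ComplexLyapunov.

(** * The Frobenius norm *)

Section Frobenius.
Variable R : realType.

(** The discriminant bound behind the Cauchy-Schwarz inequalities for the trace
    pairing and for positive semidefinite forms. *)
Lemma quad_disc (a b c : R) : 0 <= a ->
  (forall s, 0 <= a * s ^+ 2 + 2 * b * s + c) -> b ^+ 2 <= a * c.
Proof.
rewrite le_eqVlt => /predU1P[<-|a0] q.
  have [->|b0] := eqVneq b 0; first by rewrite expr0n mul0r.
  have := q (- (c + 1) / (2 * b)).
  have -> : 0 * (- (c + 1) / (2 * b)) ^+ 2 + 2 * b * (- (c + 1) / (2 * b)) + c = -1.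
    by field; rewrite b0.
  by lra.
have := q (- b / a).
have -> : a * (- b / a) ^+ 2 + 2 * b * (- b / a) + c = (a * c - b ^+ 2) / a.
  by field; rewrite gt_eqF.
by rewrite pmulr_lge0 ?invr_gt0 // subr_ge0.
Qed.

Lemma frobenius_norm_ge0 m n (X : 'M[R]_(m, n)) : 0 <= frobenius_norm X.
Proof. exact: sqrtr_ge0. Qed.

Lemma frobenius_norm_sqrE m n (X : 'M[R]_(m, n)) :
  frobenius_norm X ^+ 2 = \sum_i \sum_j X i j ^+ 2.
Proof.
rewrite sqr_sqrtr // sumr_ge0 // => i _; rewrite sumr_ge0 // => j _.
exact: sqr_ge0.
Qed.

Lemma mxtrace_inner m n (X Y : 'M[R]_(m, n)) :
  \tr (X^T *m Y) = \sum_i \sum_j X i j * Y i j.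
Proof.
rewrite exchange_big; apply: eq_bigr => j _.
by rewrite mxE; apply: eq_bigr => i _; rewrite mxE.
Qed.

Lemma frobenius_norm_sqr m n (X : 'M[R]_(m, n)) :
  frobenius_norm X ^+ 2 = \tr (X^T *m X).
Proof.
rewrite frobenius_norm_sqrE mxtrace_inner.
by apply: eq_bigr => i _; apply: eq_bigr => j _; rewrite expr2.
Qed.

Lemma mxtrace_innerC m n (X Y : 'M[R]_(m, n)) : \tr (X^T *m Y) = \tr (Y^T *m X).
Proof. by rewrite -mxtrace_tr trmx_mul trmxK. Qed.

Lemma frobenius_norm_sqrD m n (X Y : 'M[R]_(m, n)) :
  frobenius_norm (X + Y) ^+ 2 =
  frobenius_norm X ^+ 2 + 2 * \tr (X^T *m Y) + frobenius_norm Y ^+ 2.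
Proof.
rewrite !frobenius_norm_sqr [(X + Y)^T]linearD /= mulmxDl !mulmxDr !mxtraceD.
by rewrite (mxtrace_innerC Y X); ring.
Qed.

Lemma frobenius_normZ m n (a : R) (X : 'M[R]_(m, n)) :
  frobenius_norm (a *: X) = `|a| * frobenius_norm X.
Proof.
apply/eqP; rewrite -(@eqrXn2 _ 2) ?mulr_ge0 ?frobenius_norm_ge0 //.
rewrite exprMn !frobenius_norm_sqr [(a *: X)^T]linearZ /= -scalemxAl -scalemxAr.
rewrite !mxtraceZ.
by rewrite mulrA -expr2 real_normK ?num_real.
Qed.

Lemma frobenius_normN m n (X : 'M[R]_(m, n)) :
  frobenius_norm (- X) = frobenius_norm X.
Proof. by rewrite -scaleN1r frobenius_normZ normrN1 mul1r. Qed.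

Lemma frobenius_norm_tr m n (X : 'M[R]_(m, n)) :
  frobenius_norm X^T = frobenius_norm X.
Proof.
rewrite /frobenius_norm exchange_big; congr Num.sqrt.
by apply: eq_bigr => i _; apply: eq_bigr => j _; rewrite mxE.
Qed.

Lemma frobenius_norm_eq0 m n (X : 'M[R]_(m, n)) :
  (frobenius_norm X == 0) = (X == 0).
Proof.
apply/idP/eqP => [|->]; last first.
  rewrite /frobenius_norm big1 ?sqrtr0 // => i _.
  by rewrite big1 // => j _; rewrite mxE expr0n.
rewrite -sqrf_eq0 frobenius_norm_sqrE psumr_eq0 => [/allP X0|i _]; last first.
  by rewrite sumr_ge0 // => j _; rewrite sqr_ge0.
apply/matrixP => i j; rewrite mxE.
have := X0 i (mem_index_enum _); rewrite psumr_eq0 => [/allP Xi|k _]; last first.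
  exact: sqr_ge0.
by have := Xi j (mem_index_enum _); rewrite sqrf_eq0 => /eqP.
Qed.

Lemma frobenius_norm0 m n : frobenius_norm (0 : 'M[R]_(m, n)) = 0.
Proof. by apply/eqP; rewrite frobenius_norm_eq0. Qed.

Lemma mxtrace_inner_sqr_le m n (X Y : 'M[R]_(m, n)) :
  \tr (X^T *m Y) ^+ 2 <= frobenius_norm X ^+ 2 * frobenius_norm Y ^+ 2.
Proof.
rewrite mulrC; apply: quad_disc; first exact: sqr_ge0.
move=> s; have := sqr_ge0 (frobenius_norm (X + s *: Y)).
rewrite frobenius_norm_sqrD frobenius_normZ exprMn real_normK ?num_real //.
by rewrite -scalemxAr linearZ /=; congr (_ <= _); ring.
Qed.

Lemma mxtrace_inner_le m n (X Y : 'M[R]_(m, n)) :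
  `|\tr (X^T *m Y)| <= frobenius_norm X * frobenius_norm Y.
Proof.
rewrite -(@ler_pXn2r _ 2) ?nnegrE ?mulr_ge0 ?frobenius_norm_ge0 //.
by rewrite real_normK ?num_real // exprMn mxtrace_inner_sqr_le.
Qed.

Lemma mxtrace_mul_le m n (X : 'M[R]_(m, n)) (Y : 'M[R]_(n, m)) :
  `|\tr (X *m Y)| <= frobenius_norm X * frobenius_norm Y.
Proof.
by rewrite -{1}[X]trmxK (le_trans (mxtrace_inner_le _ _)) ?frobenius_norm_tr.
Qed.

Lemma frobenius_normD m n (X Y : 'M[R]_(m, n)) :
  frobenius_norm (X + Y) <= frobenius_norm X + frobenius_norm Y.
Proof.
rewrite -(@ler_pXn2r _ 2) ?nnegrE ?addr_ge0 ?frobenius_norm_ge0 //.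
rewrite frobenius_norm_sqrD.
by have := le_trans (ler_norm _) (mxtrace_inner_le X Y); lra.
Qed.

Lemma frobenius_norm_mul m n p (X : 'M[R]_(m, n)) (Y : 'M[R]_(n, p)) :
  frobenius_norm (X *m Y) <= frobenius_norm X * frobenius_norm Y.
Proof.
rewrite -(@ler_pXn2r _ 2) ?nnegrE ?mulr_ge0 ?frobenius_norm_ge0 //.
rewrite exprMn -[in leRHS](frobenius_norm_tr Y) !frobenius_norm_sqrE.
rewrite big_distrl; apply: ler_sum => i _.
rewrite big_distrr; apply: ler_sum => j _ /=.
have := mxtrace_inner_sqr_le (row i X)^T (col j Y).
have -> : \tr (((row i X)^T)^T *m col j Y) = (X *m Y) i j.
  by rewrite trmxK trace_mx11 !mxE; apply: eq_bigr => k _; rewrite !mxE.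
rewrite frobenius_norm_tr -(frobenius_norm_tr (col j Y)) !frobenius_norm_sqrE.
rewrite !big_ord1.
by congr (_ <= _ * _); apply: eq_bigr => k _; rewrite !mxE.
Qed.

Lemma frobenius_norm_mxvec m n (X : 'M[R]_(m, n)) :
  frobenius_norm (mxvec X) = frobenius_norm X.
Proof.
rewrite /frobenius_norm big_ord1; congr Num.sqrt.
rewrite pair_big (reindex (uncurry (@mxvec_index m n))) /=; last first.
  exact: curry_mxvec_bij.
by apply: eq_bigr => -[i j] _ /=; rewrite mxvecE.
Qed.

Lemma frobenius_norm_row_mx_sqr m n1 n2 (X : 'M[R]_(m, n1)) (Y : 'M[R]_(m, n2)) :
  frobenius_norm (row_mx X Y) ^+ 2 = frobenius_norm X ^+ 2 + frobenius_norm Y ^+ 2.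
Proof.
rewrite !frobenius_norm_sqrE -big_split; apply: eq_bigr => i _ /=.
rewrite big_split_ord /=; congr (_ + _); apply: eq_bigr => j _.
  by rewrite row_mxEl.
by rewrite row_mxEr.
Qed.

Lemma frobenius_norm_coord m n (X : 'M[R]_(m, n)) i j :
  `|X i j| <= frobenius_norm X.
Proof.
rewrite -(@ler_pXn2r _ 2) ?nnegrE ?frobenius_norm_ge0 // real_normK ?num_real //.
rewrite frobenius_norm_sqrE (bigD1 i) // (bigD1 j) //= -addrA lerDl.
rewrite addr_ge0 ?sumr_ge0 // => [k _|k _]; first exact: sqr_ge0.
by rewrite sumr_ge0 // => l _; exact: sqr_ge0.
Qed.

Lemma normr_le_frobenius_norm m n (X : 'M[R]_(m, n)) :
  `|X| <= frobenius_norm X.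
Proof.
rewrite [leLHS]/Num.norm /= mx_normrE; apply/bigmax_leP.
by split=> [|[i j] _]; [exact: frobenius_norm_ge0 | exact: frobenius_norm_coord].
Qed.

(** The topology of matrices is given by the maximum norm; with
    [normr_le_frobenius_norm] this allows estimates in the Frobenius norm to be
    used for boundedness and for differentiability. *)
Lemma frobenius_norm_le_normr m n (X : 'M[R]_(m, n)) :
  frobenius_norm X <= Num.sqrt (m * n)%:R * `|X|.
Proof.
rewrite -(@ler_pXn2r _ 2) ?nnegrE ?mulr_ge0 ?frobenius_norm_ge0 ?sqrtr_ge0 //.
rewrite exprMn frobenius_norm_sqrE sqr_sqrtr //.
apply: (@le_trans _ _ (\sum_(i < m) \sum_(j < n) `|X| ^+ 2)).
  apply: ler_sum => i _; apply: ler_sum => j _.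
  rewrite -real_normK ?num_real // ler_pXn2r ?nnegrE //.
  rewrite [leRHS]/Num.norm /= mx_normrE; apply/bigmax_geP; right => /=.
  by exists (i, j).
under eq_bigr do rewrite sumr_const card_ord.
by rewrite sumr_const card_ord -mulrnA mulrC mulr_natr mulnC.
Qed.

End Frobenius.

(** * Positive semidefinite quadratic forms *)

Section QuadraticForm.
Variable R : realType.

Definition qform n (M : 'M[R]_n) (x : 'cV[R]_n) : R := (x^T *m M *m x) 0 0.

Definition sym_psd n (M : 'M[R]_n) : Prop :=
  M^T = M /\ forall x, 0 <= qform M x.

Lemma qformD n (M N : 'M[R]_n) x : qform (M + N) x = qform M x + qform N x.
Proof. by rewrite /qform mulmxDr mulmxDl mxE. Qed.

Lemma qformZ n a (M : 'M[R]_n) x : qform (a *: M) x = a * qform M x.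
Proof. by rewrite /qform -scalemxAr -scalemxAl mxE. Qed.

Lemma qformN n (M : 'M[R]_n) x : qform (- M) x = - qform M x.
Proof. by rewrite -scaleN1r qformZ mulN1r. Qed.

Lemma qformB n (M N : 'M[R]_n) x : qform (M - N) x = qform M x - qform N x.
Proof. by rewrite qformD qformN. Qed.

Lemma trmx_coord00 (x : 'M[R]_1) : x^T 0 0 = x 0 0.
Proof. by rewrite mxE. Qed.

Lemma qform_tr n (M : 'M[R]_n) x : qform M^T x = qform M x.
Proof.
by rewrite /qform -[in RHS]trmx_coord00 !trmx_mul trmxK mulmxA.
Qed.

Lemma qform1 n (x : 'cV[R]_n) : qform 1%:M x = frobenius_norm x ^+ 2.
Proof. by rewrite /qform mulmx1 frobenius_norm_sqr trace_mx11. Qed.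

Lemma qform_congr n m (M : 'M[R]_n) (L : 'M[R]_(n, m)) x :
  qform (L^T *m M *m L) x = qform M (L *m x).
Proof. by rewrite /qform trmx_mul !mulmxA. Qed.

Lemma qform_gram k n (L : 'M[R]_(k, n)) x :
  qform (L^T *m L) x = frobenius_norm (L *m x) ^+ 2.
Proof. by rewrite -[X in X *m L]mulmx1 qform_congr qform1. Qed.

Lemma qform_cross n (M : 'M[R]_n) x y (s : R) : M^T = M ->
  qform M (x + s *: y) =
  qform M y * s ^+ 2 + 2 * (x^T *m M *m y) 0 0 * s + qform M x.
Proof.
move=> Ms; have E : (y^T *m M *m x) 0 0 = (x^T *m M *m y) 0 0.
  by rewrite -[in RHS]trmx_coord00 !trmx_mul trmxK Ms mulmxA.
rewrite /qform [(x + s *: y)^T]linearD /= [(s *: y)^T]linearZ /=.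
rewrite !mulmxDl !mulmxDr -!scalemxAl -!scalemxAr.
have mxD (u w : 'M[R]_1) : (u + w) 0 0 = u 0 0 + w 0 0 by rewrite mxE.
have mxZ a (u : 'M[R]_1) : (a *: u) 0 0 = a * u 0 0 by rewrite mxE.
by rewrite !(mxD, mxZ) E; ring.
Qed.

Lemma qform0 n (M : 'M[R]_n) : qform M 0 = 0.
Proof. by rewrite /qform mulmx0 mxE. Qed.

Lemma qform_le n (M : 'M[R]_n) x :
  `|qform M x| <= frobenius_norm M * frobenius_norm x ^+ 2.
Proof.
have -> : qform M x = \tr (x^T *m (M *m x)) by rewrite trace_mx11 mulmxA.
apply: le_trans (mxtrace_inner_le _ _) _.
rewrite expr2 [leRHS]mulrCA.
by rewrite ler_wpM2l ?frobenius_norm_ge0 ?frobenius_norm_mul.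
Qed.

Lemma qform_delta n (M : 'M[R]_n) j : qform M (delta_mx j 0) = M j j.
Proof. by rewrite /qform trmx_delta -rowE -colE !mxE. Qed.

Lemma mxtrace_congr n m (M : 'M[R]_m) (L : 'M[R]_(m, n)) :
  \tr (L^T *m M *m L) = \sum_j qform M (col j L).
Proof. by apply: eq_bigr => j _; rewrite -qform_delta qform_congr -colE. Qed.

Lemma posdef_psd n (M : 'M[R]_n) : sym_posdef M -> sym_psd M.
Proof.
move=> [Ms Mp]; split=> // x; have [->|/Mp/ltW//] := eqVneq x 0.
by rewrite qform0.
Qed.

Lemma posdef1 n : sym_posdef (1%:M : 'M[R]_n).
Proof.
split=> [|x x0]; first exact: trmx1.
rewrite -[ltRHS]/(qform _ _) qform1 exprn_gt0 // lt_def frobenius_norm_ge0.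
by rewrite frobenius_norm_eq0 x0.
Qed.

Lemma psd_cauchy_schwarz n (M : 'M[R]_n) x y : sym_psd M ->
  (x^T *m M *m y) 0 0 ^+ 2 <= qform M x * qform M y.
Proof.
move=> [Ms Mp]; rewrite mulrC; apply: quad_disc => [|s]; first exact: Mp.
by rewrite -qform_cross.
Qed.

Lemma psd_kernel n (M : 'M[R]_n) x : sym_psd M -> qform M x = 0 -> M *m x = 0.
Proof.
move=> Mpsd Mx0; have := psd_cauchy_schwarz (M *m x) x Mpsd.
rewrite Mx0 mulr0 -mulmxA -trace_mx11 -frobenius_norm_sqr.
rewrite exprn_even_le0 //= sqrf_eq0 frobenius_norm_eq0.
by move=> /eqP.
Qed.

(** Cauchy-Schwarz on two basis vectors bounds the square of each entry by the
    product of the two diagonal entries; these products sum to the square of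
    the trace.  This is how the cost, a trace, controls the whole solution of
    the Lyapunov equation. *)
Lemma psd_norm_le_trace n (M : 'M[R]_n) : sym_psd M ->
  frobenius_norm M <= \tr M.
Proof.
move=> Mpsd.
have E i j : ((delta_mx i 0 : 'cV[R]_n)^T *m M *m (delta_mx j 0 : 'cV_n)) 0 0 = M i j.
  by rewrite trmx_delta -rowE -colE !mxE.
have D i : 0 <= M i i by rewrite -E; have [_] := Mpsd; apply.
have T0 : 0 <= \tr M by rewrite sumr_ge0.
rewrite -(@ler_pXn2r _ 2) ?nnegrE ?frobenius_norm_ge0 //.
rewrite frobenius_norm_sqrE expr2 [in leRHS]/mxtrace big_distrl.
apply: ler_sum => i _; rewrite /= big_distrr; apply: ler_sum => j _ /=.
by have := psd_cauchy_schwarz (delta_mx i 0) (delta_mx j 0) Mpsd; rewrite /qform !E.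
Qed.

Lemma psd_trace_ge0 n (M : 'M[R]_n) : sym_psd M -> 0 <= \tr M.
Proof.
by move=> /psd_norm_le_trace; apply: le_trans; exact: frobenius_norm_ge0.
Qed.

Lemma posdef_unit n (M : 'M[R]_n) : sym_posdef M -> M \in unitmx.
Proof.
move=> [Ms Mp]; rewrite -row_free_unit -kermx_eq0; apply/eqP/row_matrixP => i.
rewrite row0; set v := row i _; apply/eqP; apply: contraT => v0.
have := Mp v^T; rewrite trmxK -{1}[v]trmxK trmx_eq0 trmxK v0 => /(_ isT).
have -> : v *m M = 0 by rewrite /v -row_mul mulmx_ker row0.
by rewrite mul0mx mxE ltxx.
Qed.

(** A lower bound for the smallest eigenvalue without spectral theory:
    Cauchy-Schwarz for the form M applied to x and M^-1 x reads
    |x|^4 <= (x^T M x) (x^T M^-1 x), and the last factor is at most a constant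
    times |x|^2. *)
Lemma posdef_lower n (M : 'M[R]_n) : sym_posdef M ->
  exists2 q : R, 0 < q & forall x, q * frobenius_norm x ^+ 2 <= qform M x.
Proof.
move=> Mpd; have [Ms Mp] := Mpd; have Mpsd := posdef_psd Mpd.
pose k := frobenius_norm M * frobenius_norm (invmx M) ^+ 2 + 1.
have k0 : 0 < k by rewrite ltr_wpDl // mulr_ge0 ?frobenius_norm_ge0 ?sqr_ge0.
exists k^-1 => [|x]; first by rewrite invr_gt0.
have [->|x0] := eqVneq x 0; first by rewrite frobenius_norm0 qform0 expr0n mulr0.
have x_gt0 : 0 < frobenius_norm x ^+ 2.
  by rewrite exprn_gt0 // lt_def frobenius_norm_ge0 frobenius_norm_eq0 x0.
rewrite mulrC ler_pdivrMr //.
have := psd_cauchy_schwarz x (invmx M *m x) Mpsd.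
rewrite -mulmxA mulKVmx ?posdef_unit // -trace_mx11 -frobenius_norm_sqr => cs.
rewrite -(ler_pM2r x_gt0) -expr2 (le_trans cs) // -mulrA.
rewrite ler_wpM2l //; first by have [_ /(_ x)] := Mpsd.
apply: le_trans (ler_norm _) _; apply: le_trans (qform_le _ _) _.
rewrite /k mulrDl mul1r -[leLHS]addr0 lerD ?sqr_ge0 // -mulrA.
rewrite ler_wpM2l ?frobenius_norm_ge0 // -exprMn ler_pXn2r ?nnegrE //.
- exact: frobenius_norm_mul.
- exact: frobenius_norm_ge0.
- by rewrite mulr_ge0 ?frobenius_norm_ge0.
Qed.

End QuadraticForm.

(** * The real Lyapunov equation *)

Section RealToComplex.
Local Open Scope sesquilinear_scope.
Variable R : realType.
Local Notation toC := (map_mx (real_complex R)).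

Lemma Re_complex (z : R[i]) : 'Re z = real_complex R (complex.Re z).
Proof. by rewrite ReE ReJ_add. Qed.

Lemma map_real_complex_trC m n (X : 'M[R]_(m, n)) : (toC X)^t* = toC X^T.
Proof.
by apply/matrixP => i j; rewrite !mxE; exact: conjc_real.
Qed.

(** For symmetric S the cross terms between the real and imaginary parts of v
    cancel.  This transfers definiteness between the real and the complex
    forms, and with it both directions of Lyapunov's theorem. *)
Lemma hermitian_form_real n (S : 'M[R]_n) (v : 'rV[R[i]]_n) : S^T = S ->
  (v *m toC S *m v^t*) 0 0 =
  real_complex R (qform S (map_mx (@complex.Re R) v)^T +
                  qform S (map_mx (@complex.Im R) v)^T).
Proof.
move=> Ss; set a := map_mx _ v; set b := map_mx (@complex.Im R) v.
have vE : v = toC a + 'i *: toC b.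
  by apply/rowP => j; rewrite !mxE; exact: complexE.
have vt : v^t* = toC a^T - 'i *: toC b^T.
  by rewrite vE [(_ + _)^T]linearD /= [(_ *: _)^T]linearZ /= map_mxD map_mxZ
    !map_real_complex_trC /= conjCi scaleNr.
have mxD (u w : 'M[R[i]]_1) : (u + w) 0 0 = u 0 0 + w 0 0 by rewrite mxE.
have mxZ k (u : 'M[R[i]]_1) : (k *: u) 0 0 = k * u 0 0 by rewrite mxE.
have mxN (u : 'M[R[i]]_1) : (- u) 0 0 = - u 0 0 by rewrite mxE.
have mxC (u : 'M[R]_1) : (toC u) 0 0 = real_complex R (u 0 0) by rewrite mxE.
have sym : (b *m S *m a^T) 0 0 = (a *m S *m b^T) 0 0.
  by rewrite -[in RHS]trmx_coord00 !trmx_mul trmxK Ss mulmxA.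
rewrite vt {1}vE !mulmxDl !mulmxBr -!scalemxAl -!scalemxAr -!map_mxM.
rewrite !(mxD, mxZ, mxN, mxC) sym /qform !trmxK rmorphD /=.
by rewrite mulrA -expr2 sqrCi mulN1r opprK addrA subrK.
Qed.

Lemma hermitian_form_posdef n (S : 'M[R]_n) (v : 'rV[R[i]]_n) :
  sym_posdef S -> v != 0 -> 0 < (v *m toC S *m v^t*) 0 0.
Proof.
move=> Spd v0; have [Ss Sp] := Spd; rewrite hermitian_form_real // ltcR.
have [_ Spsd] := posdef_psd Spd.
have [a0|a0] := eqVneq ((map_mx (@complex.Re R) v)^T) 0; last first.
  by rewrite ltr_pwDl //; exact: Sp.
rewrite ltr_wpDl // ?Spsd //; apply: Sp; apply: contra v0 => /eqP b0.
apply/eqP/rowP => j; rewrite mxE [v 0 j]complexE.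
have := congr1 (fun w : 'cV_n => w j 0) a0.
have := congr1 (fun w : 'cV_n => w j 0) b0.
by rewrite !mxE => -> ->; rewrite rmorph0 mulr0 addr0.
Qed.

Lemma eigenvalue_tr (F : fieldType) n (M : 'M[F]_n) a :
  eigenvalue M^T a = eigenvalue M a.
Proof.
rewrite !eigenvalue_root_char /char_poly -det_tr; congr (root (\det _) a).
by apply/matrixP => i j; rewrite !mxE eq_sym.
Qed.

End RealToComplex.

Section Lyapunov.
Local Open Scope sesquilinear_scope.
Variable R : realType.
Local Notation toC := (map_mx (real_complex R)).

Definition lyap n (M X : 'M[R]_n) : 'M[R]_n := X *m M + M^T *m X.

Lemma lyap_is_linear n (M : 'M[R]_n) : linear (lyap M).
Proof.
move=> a X Y; rewrite /lyap mulmxDl mulmxDr -scalemxAl -scalemxAr scalerDr.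
by rewrite addrACA.
Qed.

HB.instance Definition _ n (M : 'M[R]_n) :=
  GRing.isLinear.Build R _ _ _ (lyap M) (lyap_is_linear M).

Lemma lyap_tr n (M X : 'M[R]_n) : (lyap M X)^T = lyap M X^T.
Proof. by rewrite /lyap linearD /= !trmx_mul trmxK addrC. Qed.

(** The adjoint of [lyap M] for the trace pairing is [lyap M^T].  Applied to the
    solution Y of lyap M^T Y = -1, it expresses the trace of a solution as a
    linear functional of the right-hand side. *)
Lemma lyap_dual n (M X Y : 'M[R]_n) : \tr (lyap M X *m Y) = \tr (X *m lyap M^T Y).
Proof.
rewrite /lyap trmxK mulmxDl mulmxDr !mxtraceD addrC !mulmxA; congr (_ + _).
by rewrite -mulmxA mxtrace_mulC.
Qed.

(** The equation reads X M = (- M^T) X, and the spectra of M and - M^T lie in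
    opposite open half planes. *)
Lemma lyap_inj n (M X : 'M[R]_n) : hurwitz M -> lyap M X = 0 -> X = 0.
Proof.
move=> Mh /eqP; rewrite addr_eq0 => /eqP XM.
apply: (@map_mx_inj _ _ (real_complex R)); rewrite map_mx0.
apply: (@sylvester_inj _ _ _ (toC M) (toC (- M^T))) => [|z zM].
  by rewrite -!map_mxM XM mulNmx.
apply/negP => /eigenvalueP [v vM v0].
have : eigenvalue (toC M) (- z).
  rewrite -eigenvalue_tr; apply/eigenvalueP; exists v => //.
  by rewrite map_trmx scaleNr -vM map_mxN mulmxN opprK.
by move=> /Mh; have := Mh _ zM; rewrite linearN /=; lra.
Qed.

Lemma lyap_mx_unit n (M : 'M[R]_n) : hurwitz M -> lin_mx (lyap M) \in unitmx.
Proof.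
move=> Mh; rewrite -row_free_unit -kermx_eq0; apply/eqP/row_matrixP => i.
rewrite row0; set v := row i _.
have : v *m lin_mx (lyap M) = 0 by rewrite /v -row_mul mulmx_ker row0.
rewrite mul_rV_lin => /eqP; rewrite mxvec_eq0 => /eqP /(lyap_inj Mh) v0.
by rewrite -[v]vec_mxK v0 linear0.
Qed.

Lemma lyap_solve n (M C : 'M[R]_n) : hurwitz M -> exists X, lyap M X = C.
Proof.
move=> /lyap_mx_unit Mu.
exists (vec_mx (mxvec C *m invmx (lin_mx (lyap M)))).
by apply: (can_inj mxvecK); rewrite -mul_rV_lin mulmxKV.
Qed.

Lemma hurwitz_tr n (M : 'M[R]_n) : hurwitz M -> hurwitz M^T.
Proof.
move=> Mh z; rewrite -map_trmx eigenvalue_tr; exact: Mh.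
Qed.

Lemma lyap_bound n (M : 'M[R]_n) : hurwitz M ->
  exists2 c : R, 0 <= c &
    forall X, frobenius_norm X <= c * frobenius_norm (lyap M X).
Proof.
move=> /lyap_mx_unit Mu; exists (frobenius_norm (invmx (lin_mx (lyap M)))).
  exact: frobenius_norm_ge0.
move=> X; rewrite -[X in frobenius_norm X <= _]mxvecK -frobenius_norm_mxvec.
rewrite vec_mxK -[mxvec X](mulmxK Mu) mul_vec_lin mulrC.
by rewrite (le_trans (frobenius_norm_mul _ _)) // frobenius_norm_mxvec.
Qed.

Lemma lyap_posdef n (M X C : 'M[R]_n) : hurwitz M -> lyap M X = - C ->
  sym_posdef C -> sym_posdef X.
Proof.
move=> Mh MX Cpd; have [Cs _] := Cpd.
have Xs : X^T = X.
  apply/eqP; rewrite -subr_eq0; apply/eqP/(lyap_inj Mh).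
  by rewrite linearB /= -lyap_tr MX linearN /= Cs subrr.
split=> // x x0.
have xC : toC x^T != 0 by rewrite map_mx_eq0 trmx_eq0.
have : 0 < (toC x^T *m toC X *m (toC x^T)^t*) 0 0.
  apply: (@lyapunov_hermitian_pos _ _ (toC M^T)); last exact: xC.
  - by rewrite map_real_complex_trC Xs.
  - move=> a aM; rewrite Re_complex -[0]/(real_complex R 0) ltcR; apply: Mh.
    by rewrite -eigenvalue_tr map_trmx.
  move=> v v0; rewrite map_real_complex_trC trmxK -!map_mxM -map_mxD addrC.
  rewrite -/(lyap M X) MX map_mxN mulmxN mulNmx mxE oppr_lt0.
  exact: hermitian_form_posdef.
by rewrite map_real_complex_trC trmxK -!map_mxM mxE ltcR.
Qed.

(** The comparison principle for Lyapunov equations: by linearity, solutions of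
    the equation are ordered like its right-hand sides.  It follows from the
    definite case by adding e times the solution for the identity matrix. *)
Lemma lyap_psd n (M X C : 'M[R]_n) : hurwitz M -> lyap M X = - C ->
  sym_psd C -> sym_psd X.
Proof.
move=> Mh MX [Cs Cp].
have Xs : X^T = X.
  apply/eqP; rewrite -subr_eq0; apply/eqP/(lyap_inj Mh).
  by rewrite linearB /= -lyap_tr MX linearN /= Cs subrr.
split=> // x.
have [I MI] := lyap_solve (- 1%:M) Mh.
have Ipd := lyap_posdef Mh MI (posdef1 R n).
rewrite -[qform X x]addr0 leNgt; apply/negP => Xx.
have Ix : 0 <= qform I x by have [_] := posdef_psd Ipd; apply.
(* Small enough for X + e I to stay negative at x. *)
pose e := - qform X x / (qform I x + 1).
have e0 : 0 < e by rewrite divr_gt0 ?oppr_gt0 ?ltr_wpDl // -[ltLHS]addr0.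
have : sym_posdef (X + e *: I).
  apply: (@lyap_posdef _ M _ (C + e%:M) Mh).
    by rewrite linearD linearZ /= MX MI scalerN opprD scale_scalar_mx mulr1.
  split=> [|y y0]; first by rewrite linearD /= Cs tr_scalar_mx.
  rewrite -[ltRHS]/(qform _ _) qformD ltr_wpDl // -scalemx1 qformZ.
  by rewrite mulr_gt0 //; have [_ /(_ y y0)] := posdef1 R n.
case/posdef_psd=> _ /(_ x); rewrite qformD qformZ /e.
rewrite addr0 in Xx.
have : - qform X x / (qform I x + 1) * qform I x < - qform X x.
  rewrite mulrAC ltr_pdivrMr ?ltr_wpDl // ltr_pM2l ?oppr_gt0 //; lra.
lra.
Qed.

(** For an eigenvector v of M^T with eigenvalue z, the form of [lyap M P] at v is
    2 Re(z) (v P v^* ), with v P v^* > 0. *)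
Lemma hurwitz_certificate n (M P : 'M[R]_n) : sym_posdef P ->
  (forall x, x != 0 -> qform (lyap M P) x < 0) -> hurwitz M.
Proof.
move=> Ppd Mneg z; rewrite -eigenvalue_tr map_trmx => /eigenvalueP[v vM v0].
have Lpd : sym_posdef (- lyap M P).
  split=> [|x x0]; first by rewrite linearN /= lyap_tr; have [->] := Ppd.
  by rewrite -[ltRHS]/(qform _ _) qformN oppr_gt0 Mneg.
have := hermitian_form_posdef Lpd v0.
have Pv := hermitian_form_posdef Ppd v0.
rewrite map_mxN mulmxN mulNmx mxE oppr_gt0 /lyap map_mxD !map_mxM mulmxDr mulmxDl.
have Mv : toC M *m v^t* = z^* *: v^t*.
  have := trmxC_mul v (toC M^T).
  by rewrite map_real_complex_trC trmxK vM [(_ *: _)^T]linearZ /= map_mxZ.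
rewrite !mulmxA vM -[v *m _ *m _ *m _]mulmxA Mv -scalemxAr -!scalemxAl.
have mxD (u w : 'M[R[i]]_1) : (u + w) 0 0 = u 0 0 + w 0 0 by rewrite mxE.
have mxZ k (u : 'M[R[i]]_1) : (k *: u) 0 0 = k * u 0 0 by rewrite mxE.
rewrite !(mxD, mxZ) -mulrDl addrC mulrC pmulr_rlt0 // => zz.
have : 'Re z < 0 by rewrite ReE pmulr_llt0 // invr_gt0.
by rewrite Re_complex -[0]/(real_complex R 0) ltcR.
Qed.

End Lyapunov.

(** * The LQR cost on stabilizing gains *)

Section LQR.
Variables (R : realType) (n m : nat).
Variables (A : 'M[R]_n) (B : 'M[R]_(n, m)) (Q : 'M[R]_n) (S : 'M[R]_m).
Hypotheses (Q_pd : sym_posdef Q) (S_pd : sym_posdef S).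
Implicit Types (K H : 'M[R]_(m, n)) (P X : 'M[R]_n).

Definition closed_loop K : 'M[R]_n := A - B *m K.

Definition stage_cost K : 'M[R]_n := K^T *m S *m K + Q.

Local Notation J := (lqr_cost A B Q S).
Local Notation sol := (lyapunov_sol A B Q S).

Lemma lyapunov_eqE K P :
  lyapunov_eq A B Q S K P <-> lyap (closed_loop K) P = - stage_cost K.
Proof.
rewrite /lyapunov_eq /lyap -addrA -/(stage_cost K); split=> [/eqP|->].
  by rewrite addr_eq0 => /eqP.
by rewrite addNr.
Qed.

Lemma qform_stage_cost K x :
  qform (stage_cost K) x = qform S (K *m x) + qform Q x.
Proof. by rewrite qformD qform_congr. Qed.

Lemma stage_cost_posdef K : sym_posdef (stage_cost K).
Proof.
have [Qs Qp] := Q_pd; have [Ss _] := S_pd; split=> [|x x0].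
  by rewrite linearD /= !trmx_mul trmxK Ss Qs mulmxA.
rewrite -[ltRHS]/(qform _ _) qform_stage_cost ltr_wpDl //; last exact: Qp.
by have [_ ] := posdef_psd S_pd.
Qed.

Lemma lyapunov_sol_eq K : stabilizing A B K ->
  lyap (closed_loop K) (sol K) = - stage_cost K.
Proof.
move=> Kst; apply/lyapunov_eqE.
apply: (@getPex _ [set P | lyapunov_eq A B Q S K P]).
have [P KP] := lyap_solve (- stage_cost K) Kst.
by exists P; apply/lyapunov_eqE.
Qed.

Lemma lyapunov_sol_unique K P : stabilizing A B K ->
  lyap (closed_loop K) P = - stage_cost K -> P = sol K.
Proof.
move=> Kst KP; apply/eqP; rewrite -subr_eq0; apply/eqP/(lyap_inj Kst).
by rewrite linearB /= KP lyapunov_sol_eq // subrr.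
Qed.

Lemma lyapunov_sol_posdef K : stabilizing A B K -> sym_posdef (sol K).
Proof.
by move=> Kst; exact: lyap_posdef Kst (lyapunov_sol_eq Kst) (stage_cost_posdef K).
Qed.

(** A positive semidefinite solution is automatically definite: on a vector x of
    its kernel the left-hand side of the Lyapunov equation has value 0, whereas
    the stage cost is positive definite.  Hence stability is a closed condition
    on pairs (K, P), although it is an open one on K. *)
Lemma feasible_stabilizing K P : sym_psd P ->
  lyap (closed_loop K) P = - stage_cost K -> stabilizing A B K.
Proof.
move=> Ppsd KP; have [Ps Pp] := Ppsd; have [_ Wp] := stage_cost_posdef K.
apply: (@hurwitz_certificate _ _ _ P) => [|x x0]; last first.
  by rewrite KP qformN oppr_lt0; exact: Wp.
split=> // x x0; rewrite -[ltRHS]/(qform _ _) lt_def Pp andbT.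
apply/eqP => /(psd_kernel Ppsd) Px0.
have := Wp _ x0; rewrite -[ltRHS]/(qform _ _) -oppr_lt0 -qformN -KP.
have xP : x^T *m P = 0 by rewrite -[P]Ps -trmx_mul Px0 trmx0.
rewrite /qform /lyap mulmxDr mulmxDl !mulmxA xP !mul0mx add0r -mulmxA Px0.
by rewrite mulmx0 mxE ltxx.
Qed.

Lemma lqr_cost_ge0 K : stabilizing A B K -> 0 <= J K.
Proof. by move=> /lyapunov_sol_posdef/posdef_psd/psd_trace_ge0. Qed.

Lemma lyapunov_sol_norm_le K : stabilizing A B K ->
  frobenius_norm (sol K) <= J K.
Proof. by move=> /lyapunov_sol_posdef/posdef_psd/psd_norm_le_trace. Qed.

Lemma input_cost_lower : exists2 q : R, 0 < q &
  forall K, q * frobenius_norm K ^+ 2 <= \tr (K^T *m S *m K).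
Proof.
have [q q0 qS] := posdef_lower S_pd; exists q => // K.
rewrite frobenius_norm_sqr -[X in _ * \tr (X *m _)]mulmx1 !mxtrace_congr.
rewrite big_distrr; apply: ler_sum => j _ /=.
by rewrite qform1 qS.
Qed.

(** Taking traces in the Lyapunov equation bounds q |K|^2 by
    2 J(K) (|A| + |B| |K|), where q is a lower bound for S.  When |K| > 1, one
    power of |K| cancels: |K| grows at most linearly in J(K). *)
Lemma lqr_cost_coercive : exists2 c : R, 0 <= c &
  forall K, stabilizing A B K -> frobenius_norm K <= 1 + c * J K.
Proof.
have [q q0 qS] := input_cost_lower.
pose a := frobenius_norm A; pose b := frobenius_norm B.
have a0 : 0 <= a by exact: frobenius_norm_ge0.
have b0 : 0 <= b by exact: frobenius_norm_ge0.
exists (2 * (a + b) / q) => [|K Kst].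
  by rewrite divr_ge0 ?(ltW q0) // mulr_ge0 ?addr_ge0.
have J0 := lqr_cost_ge0 Kst.
set k := frobenius_norm K; have k0 : 0 <= k by exact: frobenius_norm_ge0.
have [k1|k1] := lerP k 1.
  rewrite (le_trans k1) // lerDl mulr_ge0 // divr_ge0 ?(ltW q0) //.
  by rewrite mulr_ge0 ?addr_ge0.
have trQ : 0 <= \tr Q by exact/psd_trace_ge0/posdef_psd.
have E : 2 * \tr (sol K *m closed_loop K) + \tr (K^T *m S *m K) + \tr Q = 0.
  have := congr1 mxtrace (lyapunov_sol_eq Kst).
  have [Ps _] := lyapunov_sol_posdef Kst.
  rewrite /lyap /stage_cost.
  have -> : (closed_loop K)^T *m sol K = (sol K *m closed_loop K)^T.
    by rewrite trmx_mul Ps.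
  by rewrite linearN /= !mxtraceD mxtrace_tr; lra.
have T : `|\tr (sol K *m closed_loop K)| <= J K * (a + b * k).
  apply: le_trans (mxtrace_mul_le _ _) _.
  apply: ler_pM; rewrite ?frobenius_norm_ge0 ?lyapunov_sol_norm_le //.
  apply: le_trans (frobenius_normD _ _) _; rewrite frobenius_normN.
  by rewrite lerD2l frobenius_norm_mul.
have qk : q * k * k <= 2 * (a + b) * J K * k.
  have qkk : q * k * k <= 2 * (J K * (a + b * k)).
    rewrite -mulrA -expr2 (le_trans (qS K)) //.
    by move: T; rewrite ler_norml => /andP[]; lra.
  rewrite (le_trans qkk) // -!mulrA ler_pM2l //.
  rewrite mulrCA ler_wpM2l // mulrDl lerD // ler_peMr // ltW //.
have kpos : 0 < k by rewrite (lt_trans _ k1).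
rewrite ler_wpDl // mulrAC ler_pdivlMr // mulrC.
by rewrite -(ler_pM2r kpos).
Qed.

Lemma stage_costD K H : stage_cost (K + H) - stage_cost K =
  K^T *m S *m H + (K^T *m S *m H)^T + H^T *m S *m H.
Proof.
have [Ss _] := S_pd.
rewrite /stage_cost [(K + H)^T]linearD /= !mulmxDl !mulmxDr !trmx_mul trmxK Ss.
rewrite !mulmxA; apply/matrixP => i j.
move: (K^T *m S *m K) (K^T *m S *m H) (H^T *m S *m K) (H^T *m S *m H) => X1 X2 X3 X4.
by rewrite !mxE; ring.
Qed.

Lemma lyap_closed_loopD K H P : P^T = P ->
  lyap (closed_loop (K + H)) P =
  lyap (closed_loop K) P - (P *m B *m H + (P *m B *m H)^T).
Proof.
move=> Ps; rewrite /lyap /closed_loop [B *m (_ + _)]mulmxDr opprD addrA.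
rewrite [X in X^T]addrC.
have -> : (P *m B *m H)^T = (B *m H)^T *m P by rewrite -mulmxA trmx_mul Ps.
rewrite -mulmxA [(_ + _)^T]linearD /= [(- _)^T]linearN /= mulmxBr mulmxDl mulNmx.
move: (P *m _) (P *m _) (_ *m P) (_ *m P) => X1 X2 X3 X4.
by apply/matrixP => i j; rewrite !mxE; ring.
Qed.

(** The solution at K remains a strict Lyapunov function for nearby gains. *)
Lemma stabilizing_open K : stabilizing A B K ->
  exists2 d : R, 0 < d & forall H, frobenius_norm H <= d -> stabilizing A B (K + H).
Proof.
move=> Kst; set P := sol K; have Ppd : sym_posdef P by exact: lyapunov_sol_posdef.
have [q q0 qW] := posdef_lower (stage_cost_posdef K).
set b := frobenius_norm (P *m B).
have b0 : 0 <= b by exact: frobenius_norm_ge0.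
exists (q / (2 * b + 1)) => [|H Hd]; first by rewrite divr_gt0 // ltr_wpDl ?mulr_ge0.
apply: (hurwitz_certificate Ppd) => x x0.
have [Ps _] := Ppd.
rewrite -/(closed_loop _) lyap_closed_loopD // lyapunov_sol_eq //.
rewrite qformB qformN (qformD (P *m B *m H)) qform_tr.
have := qform_le (P *m B *m H) x; rewrite ler_norml => /andP[+ _].
have := qW x; have : 0 < frobenius_norm x ^+ 2.
  by rewrite exprn_gt0 // lt_def frobenius_norm_ge0 frobenius_norm_eq0 x0.
set l := frobenius_norm x ^+ 2 => l0.
have : frobenius_norm (P *m B *m H) * l * 2 < q * l.
  rewrite mulrAC ltr_pM2r //.
  apply: (@le_lt_trans _ _ (b * (q / (2 * b + 1)) * 2)).
    rewrite ler_pM2r // (le_trans (frobenius_norm_mul _ _)) //.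
    by rewrite ler_wpM2l.
  rewrite mulrA mulrAC ltr_pdivrMr; last by rewrite ltr_wpDl ?mulr_ge0.
  by lra.
lra.
Qed.

Lemma lyapunov_sol_diff K H : stabilizing A B K -> stabilizing A B (K + H) ->
  let Z := (K^T *m S - sol (K + H) *m B) *m H in
  lyap (closed_loop K) (sol (K + H) - sol K) = - (Z + Z^T + H^T *m S *m H).
Proof.
move=> Kst KHst Z.
have [Ps _] := lyapunov_sol_posdef KHst.
have := lyap_closed_loopD K H Ps; rewrite lyapunov_sol_eq // => /eqP.
rewrite eq_sym subr_eq => /eqP E.
rewrite linearB /= E lyapunov_sol_eq // opprK addrAC.
have -> : stage_cost (K + H) = stage_cost K +
    (K^T *m S *m H + (K^T *m S *m H)^T + H^T *m S *m H).
  by rewrite -stage_costD subrKC.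
have -> : Z = K^T *m S *m H - sol (K + H) *m B *m H by rewrite /Z mulmxBl.
move: (K^T *m S *m H) (sol (K + H) *m B *m H) (H^T *m S *m H) (stage_cost K)
  => X1 X2 X3 X4.
by apply/matrixP => i j; rewrite !mxE; ring.
Qed.

(** The difference D of the two solutions occurs on both sides of
    [lyapunov_sol_diff]; on the right it is multiplied by H, so for small H it is
    absorbed into the left-hand side. *)
Lemma lyapunov_sol_lipschitz K : stabilizing A B K ->
  exists d c : R, [/\ 0 < d, 0 <= c & forall H, frobenius_norm H <= d ->
    stabilizing A B (K + H) /\
    frobenius_norm (sol (K + H) - sol K) <= c * frobenius_norm H].
Proof.
move=> Kst; have [d1 d10 Hst] := stabilizing_open Kst.
have [c0 c00 Kb] := lyap_bound Kst.
pose b := frobenius_norm B; pose s := frobenius_norm S.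
pose k := frobenius_norm K; pose p := frobenius_norm (sol K).
have b0 : 0 <= b by exact: frobenius_norm_ge0.
have s0 : 0 <= s by exact: frobenius_norm_ge0.
have k0 : 0 <= k by exact: frobenius_norm_ge0.
have p0 : 0 <= p by exact: frobenius_norm_ge0.
have cb0 : 0 < 4 * c0 * b + 1 by rewrite ltr_wpDl // !mulr_ge0.
exists (Num.min (Num.min d1 1) (4 * c0 * b + 1)^-1).
exists (2 * c0 * (2 * k * s + 2 * p * b + s)); split.
- by rewrite !lt_min d10 ltr01 invr_gt0.
- by rewrite !(mulr_ge0, addr_ge0).
move=> H; rewrite !le_min => /andP[/andP[Hd1 H1] Hcb].
have KHst := Hst H Hd1; split=> //.
have := Kb (sol (K + H) - sol K); rewrite lyapunov_sol_diff // frobenius_normN.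
set Z := (_ - _) *m H; set D := _ - _.
set h := frobenius_norm H; have h0 : 0 <= h by exact: frobenius_norm_ge0.
set e := frobenius_norm D; have e0 : 0 <= e by exact: frobenius_norm_ge0.
have Zb : frobenius_norm Z <= (k * s + (p + e) * b) * h.
  rewrite (le_trans (frobenius_norm_mul _ _)) // ler_wpM2r //.
  rewrite (le_trans (frobenius_normD _ _)) // frobenius_normN lerD //.
    by rewrite (le_trans (frobenius_norm_mul _ _)) // frobenius_norm_tr.
  rewrite (le_trans (frobenius_norm_mul _ _)) // ler_wpM2r //.
  by rewrite -[X in frobenius_norm X](subrKC (sol K)) frobenius_normD.
have Hb : frobenius_norm (H^T *m S *m H) <= s * h ^+ 2.
  rewrite (le_trans (frobenius_norm_mul _ _)) // expr2 mulrA ler_wpM2r //.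
  by rewrite (le_trans (frobenius_norm_mul _ _)) // frobenius_norm_tr mulrC.
have Lb : frobenius_norm (Z + Z^T + H^T *m S *m H) <=
    2 * ((k * s + (p + e) * b) * h) + s * h ^+ 2.
  rewrite (le_trans (frobenius_normD _ _)) // lerD //.
  by rewrite (le_trans (frobenius_normD _ _)) // frobenius_norm_tr; lra.
move=> eb.
have {}eb := le_trans eb (ler_wpM2l c00 Lb).
have hh : 0 <= c0 * s * (h - h ^+ 2).
  by rewrite !mulr_ge0 // subr_ge0 expr2 ler_piMr.
have ch : 0 <= (1 - (4 * c0 * b + 1) * h) * e.
  rewrite mulr_ge0 // subr_ge0 -ler_pdivlMl // mulr1 //.
have he : 0 <= h * e by rewrite mulr_ge0.
lra.
Qed.

(** The witness is the classical gradient 2 (S K - B^T P) Y, where Y solves the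
    dual Lyapunov equation.  Replacing the solution at K + H by the one at K in
    the exact formula for the increment costs D B H, which is quadratic in H by
    [lyapunov_sol_lipschitz]. *)
Lemma lqr_cost_expansion K : stabilizing A B K ->
  exists G : 'M[R]_(m, n), exists d c : R, [/\ 0 < d, 0 <= c &
    forall H, frobenius_norm H <= d -> stabilizing A B (K + H) /\
      `|J (K + H) - J K - \tr (G^T *m H)| <= c * frobenius_norm H ^+ 2].
Proof.
move=> Kst; have [d [c [d0 c0 Kl]]] := lyapunov_sol_lipschitz Kst.
have [Y KY] := lyap_solve (- 1%:M) (hurwitz_tr Kst).
have [Ys _] := lyap_posdef (hurwitz_tr Kst) KY (posdef1 R n).
have [Ps _] := lyapunov_sol_posdef Kst; have [Ss _] := S_pd.
exists (2 *: ((S *m K - B^T *m sol K) *m Y)); exists d.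
pose y := frobenius_norm Y.
exists (y * frobenius_norm S + 2 * (c * frobenius_norm B * y)); split; first exact: d0.
  by rewrite !(addr_ge0, mulr_ge0) ?frobenius_norm_ge0.
move=> H Hd; have [KHst Dh] := Kl H Hd; split; first exact: KHst.
set D := sol (K + H) - sol K.
have JD : J (K + H) - J K = - \tr (lyap (closed_loop K) D *m Y).
  by rewrite lyap_dual KY mulmxN mulmx1 linearN opprK /= linearB.
have trT (Z : 'M[R]_n) : \tr ((Z + Z^T) *m Y) = 2 * \tr (Z *m Y).
  rewrite mulmxDl mxtraceD -[\tr (Z^T *m Y)]mxtrace_tr trmx_mul trmxK Ys mxtrace_mulC.
  by lra.
rewrite JD lyapunov_sol_diff // mulNmx linearN /= opprK.
rewrite (mulmxDl (_ + _) (H^T *m S *m H)) mxtraceD trT.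
have -> : sol (K + H) = sol K + D by rewrite subrKC.
have -> : \tr ((K^T *m S - (sol K + D) *m B) *m H *m Y) =
    \tr ((K^T *m S - sol K *m B) *m H *m Y) - \tr (D *m B *m H *m Y).
  rewrite [(_ + D) *m B]mulmxDl opprD addrA.
  by rewrite (mulmxBl (_ - _)) (mulmxBl (_ *m H)) linearB.
have -> : \tr ((2 *: ((S *m K - B^T *m sol K) *m Y))^T *m H) =
    2 * \tr ((K^T *m S - sol K *m B) *m H *m Y).
  rewrite linearZ /= -scalemxAl mxtraceZ trmx_mul Ys linearB /= !trmx_mul trmxK.
  by rewrite Ss Ps -(mulmxA Y) [\tr (Y *m _)]mxtrace_mulC.
have -> (u v w : R) : 2 * (u - v) + w - 2 * u = w - 2 * v by ring.
rewrite [leRHS]mulrDl (le_trans (ler_normB _ _)) // lerD //.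
  rewrite (le_trans (mxtrace_mul_le _ _)) // mulrC -mulrA.
  rewrite ler_wpM2l ?frobenius_norm_ge0 //.
  rewrite (le_trans (frobenius_norm_mul _ _)) // expr2 mulrA.
  rewrite ler_wpM2r ?frobenius_norm_ge0 //.
  by rewrite (le_trans (frobenius_norm_mul _ _)) // frobenius_norm_tr mulrC.
rewrite normrM ger0_norm // -mulrA ler_pM2l //.
rewrite (le_trans (mxtrace_mul_le _ _)) // mulrAC ler_wpM2r ?frobenius_norm_ge0 //.
rewrite (le_trans (frobenius_norm_mul _ _)) // expr2 mulrA.
rewrite ler_wpM2r ?frobenius_norm_ge0 //.
rewrite (le_trans (frobenius_norm_mul _ _)) // mulrAC.
by rewrite ler_wpM2r ?frobenius_norm_ge0.
Qed.

(** * Linear growth of the cost along a high-gain ray *)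

Section Ray.
Variables (K0 : 'M[R]_(m, n)) (K0_stab : stabilizing A B K0).

Definition ray (t : R) : 'M[R]_(m, n) := K0 + t *: (B^T *m sol K0).

(** The ray points along B^T P, with P the solution at K0, so that moving along
    it adds to the Lyapunov equation of P a negative semidefinite term of size
    t. *)
Lemma lyap_ray t : lyap (closed_loop (ray t)) (sol K0) =
  - (stage_cost K0 + (2 * t) *: ((B^T *m sol K0)^T *m (B^T *m sol K0))).
Proof.
have [Ps _] := lyapunov_sol_posdef K0_stab.
rewrite opprD -(lyapunov_sol_eq K0_stab) /lyap /closed_loop /ray.
set P := sol K0; set L := B^T *m P.
have LT : L^T = P *m B by rewrite trmx_mul trmxK Ps.
set M := A - B *m K0.
have -> : A - B *m (K0 + t *: L) = M - t *: (B *m L).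
  by rewrite mulmxDr -scalemxAr opprD addrA.
have MT : (M - t *: (B *m L))^T = M^T - t *: (L^T *m B^T).
  by rewrite linearB linearZ /= trmx_mul.
rewrite MT mulmxBr mulmxBl -scalemxAr -scalemxAl -mulmxA -/L mulmxA -LT.
rewrite addrACA; congr (_ + _).
by rewrite mulrDl mul1r scalerDl opprD.
Qed.

Lemma ray_stabilizing t : 0 <= t -> stabilizing A B (ray t).
Proof.
move=> t0; apply: (@hurwitz_certificate _ _ _ (sol K0)).
  exact: lyapunov_sol_posdef.
move=> x x0; rewrite lyap_ray qformN oppr_lt0 qformD qformZ qform_gram.
rewrite ltr_pwDl //; first by have [_] := stage_cost_posdef K0; apply.
by rewrite mulr_ge0 ?sqr_ge0 // mulr_ge0.
Qed.

(** By [lyap_psd] it suffices that a multiple a t of the right-hand side for P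
    dominates the stage cost at [ray t].  The latter is quadratic in t, but so is
    t times the term of [lyap_ray]; the cross term is absorbed because S is
    positive semidefinite. *)
Lemma ray_cost : exists2 c : R, 0 <= c &
  forall t, 1 <= t -> J (ray t) <= c * t.
Proof.
set a := 2 + frobenius_norm S.
have a0 : 0 <= a by rewrite addr_ge0 ?frobenius_norm_ge0.
exists (a * J K0) => [|t t1]; first by rewrite mulr_ge0 ?lqr_cost_ge0.
have t0 : 0 <= t by rewrite (le_trans _ t1).
have st := ray_stabilizing t0.
suff : sym_psd ((a * t) *: sol K0 - sol (ray t)).
  by move=> /psd_trace_ge0; rewrite linearB linearZ /= subr_ge0 mulrAC.
set L := B^T *m sol K0.
apply: (@lyap_psd _ _ (closed_loop (ray t)) _
  ((a * t) *: (stage_cost K0 + (2 * t) *: (L^T *m L)) - stage_cost (ray t))).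
- exact: st.
- by rewrite linearB linearZ /= lyap_ray lyapunov_sol_eq // scalerN opprK opprB addrC.
have [W0s _] := stage_cost_posdef K0; have [Wts _] := stage_cost_posdef (ray t).
split=> [|x].
  rewrite linearB linearZ /= Wts linearD linearZ /= W0s trmx_mul trmxK //.
rewrite qformB qformZ qformD qformZ qform_gram !qform_stage_cost mulmxDl -scalemxAl.
have [Ss _] := S_pd; have [_ Sp] := posdef_psd S_pd.
have [_ /(_ x) Qx] := posdef_psd Q_pd.
rewrite qform_cross //.
have := Sp (K0 *m x + (- t) *: (L *m x)); rewrite qform_cross // sqrrN.
have := Sp (K0 *m x); have := Sp (L *m x).
have := le_trans (ler_norm _) (qform_le S (L *m x)).
have := frobenius_norm_ge0 S; have := sqr_ge0 (frobenius_norm (L *m x)).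
rewrite /a -/L.
set s := frobenius_norm S; set l := frobenius_norm (L *m x) ^+ 2.
set k := qform S (K0 *m x); set g := (_^T *m _ *m _) 0 0; set h := qform S (L *m x).
set q := qform Q x in Qx *.
move=> l0 s0 hl h0 k0 cross.
have tt : t <= t ^+ 2 by rewrite expr2 ler_peMl.
have : 0 <= s * t * (k + q) by rewrite !mulr_ge0 ?addr_ge0.
have : 0 <= (2 * t - 2) * k by rewrite mulr_ge0 //; lra.
have : 0 <= (2 * t - 1) * q by rewrite mulr_ge0 //; lra.
have : 0 <= (s * l - h) * t ^+ 2 by rewrite mulr_ge0 ?sqr_ge0 //; lra.
have : 0 <= l * t ^+ 2 by rewrite mulr_ge0 ?sqr_ge0.
lra.
Qed.

Lemma ray_dist t : 0 <= t ->
  frobenius_norm (ray t - K0) = t * frobenius_norm (B^T *m sol K0).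
Proof. by move=> t0; rewrite addrC addKr frobenius_normZ ger0_norm. Qed.

End Ray.

End LQR.

(** * Entrywise continuity of matrix-valued maps *)

Lemma continuous_bigsum (R : realType) (T : topologicalType) (I : Type) (r : seq I)
    (f : I -> T -> R) :
  (forall i, continuous (f i)) -> continuous (fun v => \sum_(i <- r) f i v).
Proof.
move=> fc; elim: r => [|i r IHr].
  by under eq_fun do rewrite big_nil; exact: cst_continuous.
by under eq_fun do rewrite big_cons; move=> v; apply: cvgD; [exact: fc | exact: IHr].
Qed.

Definition entrywise_continuous (R : realType) (T : topologicalType) m n
    (F : T -> 'M[R]_(m, n)) := forall i j, continuous (fun v => F v i j).

Section EntrywiseContinuous.
Variables (R : realType) (T : topologicalType).
Local Notation econt := (@entrywise_continuous R T _ _).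

Lemma econt_cst m n (X : 'M[R]_(m, n)) : econt (fun=> X).
Proof. by move=> i j; exact: cst_continuous. Qed.

Lemma econt_add m n (F G : T -> 'M[R]_(m, n)) : econt F -> econt G ->
  econt (fun v => F v + G v).
Proof.
move=> Fc Gc i j; under eq_fun do rewrite mxE.
by move=> v; apply: cvgD; [exact: Fc | exact: Gc].
Qed.

Lemma econt_opp m n (F : T -> 'M[R]_(m, n)) : econt F ->
  econt (fun v => - F v).
Proof.
by move=> Fc i j; under eq_fun do rewrite mxE; move=> v; apply: cvgN; exact: Fc.
Qed.

Lemma econt_tr m n (F : T -> 'M[R]_(m, n)) : econt F ->
  econt (fun v => (F v)^T).
Proof. by move=> Fc i j; under eq_fun do rewrite mxE; exact: Fc. Qed.

Lemma econt_mul m n p (F : T -> 'M[R]_(m, n)) (G : T -> 'M[R]_(n, p)) :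
  econt F -> econt G -> econt (fun v => F v *m G v).
Proof.
move=> Fc Gc i j; under eq_fun do rewrite mxE.
by apply: continuous_bigsum => k v; apply: cvgM; [exact: Fc | exact: Gc].
Qed.

Lemma econt_mxtrace n (F : T -> 'M[R]_n) : econt F ->
  continuous (fun v => \tr (F v)).
Proof. by move=> Fc; apply: continuous_bigsum => i; exact: Fc. Qed.

Lemma econt_frobenius_sqr m n (F : T -> 'M[R]_(m, n)) : econt F ->
  continuous (fun v => frobenius_norm (F v) ^+ 2).
Proof.
move=> Fc; under eq_fun do rewrite frobenius_norm_sqr.
by apply: econt_mxtrace; apply: econt_mul => //; exact: econt_tr.
Qed.

Lemma closed_entrywise_eq0 m n (F : T -> 'M[R]_(m, n)) : econt F ->
  closed [set v | F v = 0].
Proof.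
move=> Fc; have -> : [set v | F v = 0] =
    (fun v => frobenius_norm (F v) ^+ 2) @^-1` [set x | x = 0].
  apply/seteqP; split=> v /=; first by move=> ->; rewrite frobenius_norm0 expr0n.
  by move/eqP; rewrite sqrf_eq0 frobenius_norm_eq0 => /eqP.
by apply: preimage_closed => [v _|]; [exact: econt_frobenius_sqr | exact: closed_eq].
Qed.

Lemma closed_entrywise_psd n (F : T -> 'M[R]_n) : econt F ->
  closed [set v | sym_psd (F v)].
Proof.
move=> Fc; have -> : [set v | sym_psd (F v)] =
    [set v | (F v)^T - F v = 0] `&`
    \bigcap_x ((fun v => qform (F v) x) @^-1` [set y | 0 <= y]).
  apply/seteqP; split=> v /= [Fs Fp]; split.
  - by rewrite Fs subrr.
  - by move=> x _ /=; exact: Fp.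
  - by apply/eqP; rewrite -subr_eq0 Fs.
  - by move=> x; exact: Fp.
apply: closedI.
  by apply: closed_entrywise_eq0; apply: econt_add; [exact: econt_tr | exact: econt_opp].
apply: closed_bigI => x _; apply: preimage_closed => [v _|]; last exact: closed_ge.
by apply: econt_mul; [apply: econt_mul => //|]; exact: econt_cst.
Qed.

End EntrywiseContinuous.

(** * Identifying the gradient *)

Section Gradient.
Variable R : realType.

Lemma mxtrace_inner_linear m n (G : 'M[R]_(m, n)) :
  linear (fun H : 'M[R]_(m, n) => \tr (G^T *m H) : R^o).
Proof. by move=> a X Y; rewrite mulmxDr -scalemxAr linearD linearZ. Qed.

(** A quadratic remainder is in particular a little-o of H, so the differential
    of f at K is the pairing with G. *)
Lemma gradient_of_expansion m n (f : 'M[R]_(m, n) -> R) (K G : 'M[R]_(m, n))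
    (d c : R) : 0 < d -> 0 <= c ->
  (forall H, frobenius_norm H <= d ->
     `|f (K + H) - f K - \tr (G^T *m H)| <= c * frobenius_norm H ^+ 2) ->
  gradient f K = G.
Proof.
move=> d0 c0 fK.
pose L_mixin := GRing.isLinear.Build R 'M[R]_(m, n) R^o *:%R _ (mxtrace_inner_linear G).
pose L : {linear 'M[R]_(m, n) -> R^o} :=
  HB.pack (fun H : 'M[R]_(m, n) => \tr (G^T *m H) : R^o) L_mixin.
set k := Num.sqrt (m * n)%:R : R.
have k0 : 0 <= k by exact: sqrtr_ge0.
have ck0 : 0 < c * k * k + 1 by rewrite ltr_wpDl // !mulr_ge0.
have kk0 : 0 < k + 1 by rewrite ltr_wpDl.
have Lc : continuous L.
  apply/linear_bounded_continuous/linear_boundedP.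
  exists (frobenius_norm G * k); split; first by rewrite num_real.
  move=> r rk H; apply: le_trans (mxtrace_inner_le _ _) _.
  apply: (@le_trans _ _ (frobenius_norm G * (k * `|H|))).
    by rewrite ler_wpM2l ?frobenius_norm_ge0 ?frobenius_norm_le_normr.
  by rewrite mulrA ler_wpM2r // ltW.
have dfE : 'd f K = L :> (_ -> _).
  apply: diff_unique => //; apply/eqaddoP => e e0.
  near=> H; rewrite /= !fctE /=.
  have Hk : frobenius_norm H <= k * `|H| by exact: frobenius_norm_le_normr.
  have HH : frobenius_norm H ^+ 2 <= (k * `|H|) ^+ 2.
    by rewrite ler_pXn2r ?nnegrE ?mulr_ge0 ?frobenius_norm_ge0.
  rewrite [H + K]addrC opprD addrA; apply: le_trans (fK H _) _.
    apply: le_trans Hk _; apply: (@le_trans _ _ ((k + 1) * `|H|)).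
      by rewrite ler_wpM2r // lerDl.
    rewrite -ler_pdivlMl // ltW //; near: H; apply/nbhs_ballP.
    exists ((k + 1)^-1 * d) => [/=|H]; first by rewrite mulr_gt0 // invr_gt0.
    by rewrite -ball_normE /= sub0r normrN.
  apply: le_trans (ler_wpM2l c0 HH) _.
  rewrite (_ : c * _ = c * k * k * `|H| * `|H|); last by ring.
  rewrite ler_wpM2r //.
  apply: (@le_trans _ _ ((c * k * k + 1) * `|H|)).
    by rewrite ler_wpM2r // lerDl.
  rewrite -ler_pdivlMl // ltW //; near: H; apply/nbhs_ballP.
  exists ((c * k * k + 1)^-1 * e) => [/=|H]; first by rewrite mulr_gt0 // invr_gt0.
  by rewrite -ball_normE /= sub0r normrN.
apply/matrixP => i j; rewrite mxE dfE /=.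
rewrite mxtrace_inner (bigD1 i) //= (bigD1 j) //= !mxE !eqxx mulr1.
rewrite big1 => [|j' j'j]; last by rewrite !mxE eqxx (negbTE j'j) mulr0.
rewrite addr0 big1 ?addr0 // => i' i'i; rewrite big1 // => j' _.
by rewrite !mxE (negbTE i'i) mulr0.
Unshelve. all: by end_near.
Qed.

End Gradient.

(** * The quadratically penalised cost *)

Section PenalisedCost.
Variable R : realType.

(** The minimization takes place over the set F of the pairs (K, P) of a gain and
    a positive semidefinite solution of its Lyapunov equation with trace at most
    the cost of K0.  On F the second component is determined by the first and
    its trace is the cost, so the objective is a polynomial in the entries,
    and continuous for that reason.  Pairs are encoded as row vectors,
    for which closed bounded sets are compact. *)
Lemma lqr_penalised_min n m (A : 'M[R]_n) (B : 'M[R]_(n, m)) (Q : 'M[R]_n)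
    (S : 'M[R]_m) (K0 : 'M[R]_(m, n)) (l : R) :
  sym_posdef Q -> sym_posdef S -> stabilizing A B K0 -> 0 <= l ->
  exists2 K1, stabilizing A B K1 & forall K, stabilizing A B K ->
    lqr_cost A B Q S K1 + l * frobenius_norm (K1 - K0) ^+ 2 <=
    lqr_cost A B Q S K + l * frobenius_norm (K - K0) ^+ 2.
Proof.
move=> Qpd Spd K0st l0.
pose Kof (v : 'rV[R]_(m * n + n * n)) : 'M[R]_(m, n) := vec_mx (lsubmx v).
pose Pof (v : 'rV[R]_(m * n + n * n)) : 'M[R]_n := vec_mx (rsubmx v).
pose J := lqr_cost A B Q S; pose sol := lyapunov_sol A B Q S.
pose pack K := row_mx (mxvec K) (mxvec (sol K)).
have KofE K : Kof (pack K) = K by rewrite /Kof row_mxKl mxvecK.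
have PofE K : Pof (pack K) = sol K by rewrite /Pof row_mxKr mxvecK.
pose E v := lyap (closed_loop A B (Kof v)) (Pof v) + stage_cost Q S (Kof v).
pose F := [set v | E v = 0] `&` [set v | sym_psd (Pof v)] `&`
  [set v | \tr (Pof v) <= J K0].
have Fst v : F v -> stabilizing A B (Kof v) /\ v = pack (Kof v).
  move=> [[/= Ev Pv] _].
  have Lv : lyap (closed_loop A B (Kof v)) (Pof v) = - stage_cost Q S (Kof v).
    by apply/eqP; rewrite -addr_eq0; apply/eqP.
  have st : stabilizing A B (Kof v) by exact: feasible_stabilizing Qpd Spd _ _ Pv Lv.
  split=> //; have Psol : Pof v = sol (Kof v) by exact: lyapunov_sol_unique.
  by rewrite /pack -Psol !vec_mxK hsubmxK.
have packF K : stabilizing A B K -> J K <= J K0 -> F (pack K).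
  move=> Kst JK; split; last by rewrite /= PofE.
  split=> /=; last by rewrite PofE; exact/posdef_psd/lyapunov_sol_posdef.
  by rewrite /E PofE KofE lyapunov_sol_eq // addNr.
have Kc : entrywise_continuous Kof.
  move=> i j; have -> : (fun v => Kof v i j) =
      (fun v : 'rV_(m * n + n * n) => v 0 (lshift _ (mxvec_index i j))).
    by apply/funext => v; rewrite /Kof !mxE.
  exact: coord_continuous.
have Pc : entrywise_continuous Pof.
  move=> i j; have -> : (fun v => Pof v i j) =
      (fun v : 'rV_(m * n + n * n) => v 0 (rshift _ (mxvec_index i j))).
    by apply/funext => v; rewrite /Pof !mxE.
  exact: coord_continuous.
have Clc : entrywise_continuous (fun v => closed_loop A B (Kof v)).
  apply: econt_add; first exact: econt_cst.
  by apply: econt_opp; apply: econt_mul => //; exact: econt_cst.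
have Ec : entrywise_continuous E.
  apply: econt_add; apply: econt_add; last exact: econt_cst.
  - exact: econt_mul.
  - by apply: econt_mul => //; exact: econt_tr.
  - by apply: econt_mul => //; apply: econt_mul; [exact: econt_tr | exact: econt_cst].
have Fclosed : closed F.
  apply: closedI.
    by apply: closedI; [exact: closed_entrywise_eq0 | exact: closed_entrywise_psd].
  apply: (@preimage_closed _ _ (fun v => \tr (Pof v)) [set y | y <= J K0]).
    by move=> v _; exact: econt_mxtrace.
  exact: closed_le.
have [c c0 Kbnd] := lqr_cost_coercive A B Qpd Spd.
have J0 : 0 <= J K0 by exact: lqr_cost_ge0.
have Fbnd : bounded_set F.
  exists (1 + c * J K0 + J K0); split; first by rewrite num_real.
  move=> r rb v Fv; have [st vE] := Fst v Fv.
  have [_ /= Jv] := Fv.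
  apply: le_trans (normr_le_frobenius_norm _) _; apply: le_trans (ltW rb).
  have KJ : J (Kof v) <= J K0 by rewrite vE PofE in Jv.
  have Kv : frobenius_norm (Kof v) <= 1 + c * J K0.
    by rewrite (le_trans (Kbnd _ st)) // lerD2l ler_wpM2l.
  have Pv : frobenius_norm (sol (Kof v)) <= J K0.
    by rewrite (le_trans _ KJ) // lyapunov_sol_norm_le.
  have b0 : 0 <= 1 + c * J K0 by rewrite addr_ge0 // mulr_ge0.
  rewrite vE -(@ler_pXn2r _ 2) ?nnegrE ?(addr_ge0 b0 J0) ?frobenius_norm_ge0 //.
  rewrite frobenius_norm_row_mx_sqr !frobenius_norm_mxvec.
  have Kv2 : frobenius_norm (Kof v) ^+ 2 <= (1 + c * J K0) ^+ 2.
    by rewrite ler_pXn2r ?nnegrE ?frobenius_norm_ge0.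
  have Pv2 : frobenius_norm (sol (Kof v)) ^+ 2 <= J K0 ^+ 2.
    by rewrite ler_pXn2r ?nnegrE ?frobenius_norm_ge0.
  by have := mulr_ge0 b0 J0; lra.
pose phi v := \tr (Pof v) + l * frobenius_norm (Kof v - K0) ^+ 2.
have phic : continuous phi.
  have Dc : entrywise_continuous (fun v => Kof v - K0).
    by apply: econt_add => //; exact: econt_cst.
  have Nc := econt_frobenius_sqr Dc; have trc := econt_mxtrace Pc.
  by move=> v; exact: (cvgD (trc v) (cvgM (cvg_cst l) (Nc v))).
have F0 : F !=set0 by exists (pack K0); exact: packF.
have [v Fv vmin] := compact_EVT_min F0 (bounded_closed_compact Fbnd Fclosed)
  (continuous_subspaceT phic).
rewrite inE in Fv; have [st vE] := Fst v Fv.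
have phiE K : phi (pack K) = J K + l * frobenius_norm (K - K0) ^+ 2.
  by rewrite /phi PofE KofE.
exists (Kof v) => // K Kst; rewrite -/J -!phiE -vE.
(* A gain more expensive than K0 is not represented in F, but K0 beats it. *)
have [JK|JK] := lerP (J K) (J K0); first by apply: vmin; rewrite inE; exact: packF.
apply: (@le_trans _ _ (phi (pack K0))); first by apply: vmin; rewrite inE; exact: packF.
rewrite !phiE subrr frobenius_norm0 expr0n mulr0 lerD ?(ltW JK) //.
by rewrite mulr_ge0 ?sqr_ge0.
Qed.

(** Moving from K1 by - s V, where V is the gradient of the penalised cost, lowers
    that cost by s |V|^2 up to a term of order s^2 |V|^2; at a minimum this
    forces V = 0. *)
Lemma penalised_min_gradient n m (A : 'M[R]_n) (B : 'M[R]_(n, m)) (Q : 'M[R]_n)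
    (S : 'M[R]_m) (K0 K1 : 'M[R]_(m, n)) (l : R) :
  sym_posdef Q -> sym_posdef S -> stabilizing A B K1 -> 0 <= l ->
  (forall K, stabilizing A B K ->
    lqr_cost A B Q S K1 + l * frobenius_norm (K1 - K0) ^+ 2 <=
    lqr_cost A B Q S K + l * frobenius_norm (K - K0) ^+ 2) ->
  gradient (lqr_cost A B Q S) K1 = - (2 * l) *: (K1 - K0).
Proof.
move=> Qpd Spd K1st l0 K1min.
have [G [d [c [d0 c0 Gexp]]]] := lqr_cost_expansion Qpd Spd K1st.
rewrite (gradient_of_expansion d0 c0 (fun H Hd => (Gexp H Hd).2)).
pose V := G + (2 * l) *: (K1 - K0).
suff : V = 0 by move/eqP; rewrite addr_eq0 => /eqP ->; rewrite scaleNr.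
apply/eqP; rewrite -frobenius_norm_eq0 -sqrf_eq0 eq_le sqr_ge0 andbT leNgt.
apply/negP => V0.
set N := frobenius_norm V in V0; have N0 : 0 <= N by exact: frobenius_norm_ge0.
pose s := Num.min (d / (N + 1)) (1 / (2 * (c + l + 1))).
have s0 : 0 < s.
  by rewrite lt_min !divr_gt0 ?mulr_gt0 ?ltr_wpDl ?addr_ge0.
have sd : frobenius_norm (- s *: V) <= d.
  rewrite frobenius_normZ normrN (gtr0_norm s0) -/N.
  apply: (@le_trans _ _ (s * (N + 1))); first by rewrite ler_pM2l // lerDl.
  by rewrite -ler_pdivlMr ?ltr_wpDl // ge_min lexx.
have sc : s * (c + l + 1) <= 2^-1.
  rewrite -ler_pdivlMr ?ltr_wpDl ?addr_ge0 // ge_min; apply/orP; right.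
  by rewrite div1r invfM.
have [st ex] := Gexp _ sd.
have := K1min _ st.
have -> : K1 + - s *: V - K0 = (K1 - K0) + - s *: V by rewrite addrAC.
rewrite [in leRHS]frobenius_norm_sqrD => opt.
have VV : \tr (G^T *m (- s *: V)) + 2 * l * \tr ((K1 - K0)^T *m (- s *: V)) =
    - s * N ^+ 2.
  rewrite -!scalemxAr !mxtraceZ mulrCA -mulrDr -mxtraceZ scalemxAl -mxtraceD.
  rewrite -mulmxDl frobenius_norm_sqr.
  by rewrite [V^T]linearD /= [((2 * l) *: (K1 - K0))^T]linearZ.
move: ex; rewrite ler_norml => /andP[_ ex].
have NN : frobenius_norm (- s *: V) ^+ 2 = s ^+ 2 * N ^+ 2.
  by rewrite frobenius_normZ normrN (gtr0_norm s0) exprMn.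
rewrite NN in ex opt.
have : 0 < s * (N ^+ 2) * (1 - s * (c + l)).
  by rewrite mulr_gt0 ?(mulr_gt0 s0 V0) //; lra.
lra.
Qed.

End PenalisedCost.

(** * Failure of the Polyak-Lojasiewicz inequality *)

Lemma controllable_input_neq0 (R : realType) (n m : nat) (A : 'M[R]_n)
    (B : 'M[R]_(n, m)) : (0 < n)%N -> controllable A B -> B != 0.
Proof.
move=> n0 AB; apply: contraL n0 => /eqP B0; move: AB; rewrite /controllable B0.
have -> : \mxrow_(k < n) (A ^+ k *m (0 : 'M[R]_(n, m))) = 0.
  by apply/matrixP => i j; rewrite mxE mulmx0 !mxE.
by rewrite mxrank0 => <-.
Qed.

(** One step of the proximal point method.  At K1 the gradient of J is
    - 2 l (K1 - K0), so the inequality bounds the suboptimality of K1 by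
    4 l^2 |K1 - K0|^2; comparing the penalised cost at K1 and at K0 bounds
    l |K1 - K0|^2 by the decrease of J. *)
Lemma pl_proximal_step (R : realType) (n m : nat) (A : 'M[R]_n)
    (B : 'M[R]_(n, m)) (Q : 'M[R]_n) (S : 'M[R]_m) (Jmin mu l : R)
    (K0 : 'M[R]_(m, n)) :
  let J := lqr_cost A B Q S in
  sym_posdef Q -> sym_posdef S -> 0 < mu -> 0 < l ->
  (forall K, stabilizing A B K -> Jmin <= J K) ->
  (forall K, stabilizing A B K ->
     Num.sqrt (mu * (J K - Jmin)) <= frobenius_norm (gradient J K)) ->
  stabilizing A B K0 ->
  exists K1, [/\ stabilizing A B K1,
    l * frobenius_norm (K1 - K0) ^+ 2 <= J K0 - J K1 &
    mu * (J K1 - Jmin) <= 4 * l * (J K0 - J K1)].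
Proof.
move=> J Q_pd S_pd mu0 l0 Jmin_le PL K0st.
have [K1 K1st K1min] := lqr_penalised_min Q_pd S_pd K0st (ltW l0).
exists K1.
have lf : l * frobenius_norm (K1 - K0) ^+ 2 <= J K0 - J K1.
  have := K1min _ K0st; rewrite subrr frobenius_norm0 expr0n mulr0 addr0 -/J.
  by lra.
split=> //; have := PL _ K1st.
rewrite (penalised_min_gradient Q_pd S_pd K1st (ltW l0) K1min).
set f := frobenius_norm (K1 - K0) in lf *.
have f0 : 0 <= f by exact: frobenius_norm_ge0.
have l2 : 0 <= 2 * l by rewrite mulr_ge0 // ltW.
rewrite frobenius_normZ normrN (ger0_norm l2) -/f.
rewrite -(@ler_pXn2r _ 2) ?nnegrE ?sqrtr_ge0 ?(mulr_ge0 l2 f0) //.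
rewrite sqr_sqrtr; last by rewrite mulr_ge0 ?(ltW mu0) ?subr_ge0 ?Jmin_le.
move=> PL1; rewrite (le_trans PL1) //.
have -> : (2 * l * f) ^+ 2 = 4 * l * (l * f ^+ 2) by ring.
by rewrite ler_pM2l // mulr_gt0.
Qed.

Theorem corollary1 (R : realType) (n m : nat) (n_gt0 : (0 < n)%N)
    (A : 'M[R]_n) (B : 'M[R]_(n, m)) (Q : 'M[R]_n) (S : 'M[R]_m)
    (AB_ctrl : controllable A B) (Q_pd : sym_posdef Q) (S_pd : sym_posdef S)
    (Kstar : 'M[R]_(m, n)) (Kstar_stab : stabilizing A B Kstar)
    (Kstar_min : forall K, stabilizing A B K ->
       lqr_cost A B Q S Kstar <= lqr_cost A B Q S K) :
  ~ exists mu : R, 0 < mu /\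
      forall K, stabilizing A B K ->
        Num.sqrt (mu * (lqr_cost A B Q S K - lqr_cost A B Q S Kstar))
          <= frobenius_norm (gradient (lqr_cost A B Q S) K).
Proof.
move=> [mu [mu0 PL]].
have [g g0 Jray] := ray_cost Q_pd S_pd Kstar_stab.
have [c c0 Kcoer] := lqr_cost_coercive A B Q_pd S_pd.
set b := frobenius_norm (B^T *m lyapunov_sol A B Q S Kstar).
have b0 : 0 < b.
  rewrite lt_def frobenius_norm_ge0 frobenius_norm_eq0 andbT.
  apply: contra (controllable_input_neq0 n_gt0 AB_ctrl) => /eqP BP.
  have Pu := posdef_unit (lyapunov_sol_posdef Q_pd S_pd Kstar_stab).
  by rewrite -trmx_eq0 -[B^T](mulmxK Pu) BP mul0mx.
set J := lqr_cost A B Q S in PL Jray Kcoer Kstar_min.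
have Js0 : 0 <= J Kstar by exact: lqr_cost_ge0.
have gmu : 0 <= 4 * g / mu by rewrite divr_ge0 ?(ltW mu0) // mulr_ge0.
(* With t = s^4 and l = mu / (4 s^2), g s^4 bounds the cost at K_t, q s^3 the
   length of the proximal step, and M s^3 the distance from K_t to Kstar.  The
   summand 1 in q replaces a square root: 4 g / mu <= q^2. *)
pose q := 4 * g / mu + 1.
have q0 : 0 <= q by rewrite addr_ge0.
pose M := q + 1 + c * J Kstar + c * g + frobenius_norm Kstar.
have M0 : 0 <= M.
  have := frobenius_norm_ge0 Kstar; have := mulr_ge0 c0 Js0.
  by have := mulr_ge0 c0 g0; rewrite /M; lra.
(* Chosen such that b s > M. *)
pose s := M / b + 1.
have s1 : 1 <= s by rewrite lerDr divr_ge0 // ltW.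
have s0 : 0 < s by rewrite (lt_le_trans _ s1).
have t1 : 1 <= s ^+ 4 by rewrite exprn_ege1.
have t0 : 0 <= s ^+ 4 by rewrite exprn_ge0 // ltW.
set K0 := ray A B Q S Kstar (s ^+ 4).
have K0st : stabilizing A B K0 by exact: ray_stabilizing.
pose l := mu / (4 * s ^+ 2).
have l0 : 0 < l by rewrite divr_gt0 // mulr_gt0 // exprn_gt0.
have [K1 [K1st]] :=
  pl_proximal_step Q_pd S_pd mu0 l0 Kstar_min PL K0st.
rewrite -/J; set f := frobenius_norm (K1 - K0) => lf PL1.
have f0 : 0 <= f by exact: frobenius_norm_ge0.
have J10 : 0 <= J K1 by exact: lqr_cost_ge0.
have J0t : J K0 - J K1 <= g * s ^+ 4 by have := Jray _ t1; rewrite -/K0; lra.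
have J1 : J K1 <= J Kstar + g * s ^+ 2.
  rewrite -lerBlDl -(ler_pM2l mu0) (le_trans PL1) //.
  have -> : mu * (g * s ^+ 2) = 4 * l * (g * s ^+ 4).
    by rewrite /l; field; rewrite gt_eqF.
  by rewrite ler_pM2l // mulr_gt0.
have fq : f <= q * s ^+ 3.
  rewrite -(@ler_pXn2r _ 2) ?nnegrE ?(mulr_ge0 q0) ?exprn_ge0 ?(ltW s0) //.
  rewrite -(ler_pM2l l0) (le_trans lf) // (le_trans J0t) //.
  have -> : l * (q * s ^+ 3) ^+ 2 = (mu * q ^+ 2 / 4) * s ^+ 4.
    by rewrite /l; field; rewrite gt_eqF.
  rewrite ler_wpM2r //.
  have -> : g = mu * (4 * g / mu) / 4 by field; rewrite gt_eqF.
  rewrite ler_pM2r // ler_pM2l // /q.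
  by have := sqr_ge0 (4 * g / mu); lra.
have : b * s ^+ 4 <= M * s ^+ 3.
  rewrite mulrC -(ray_dist A B Q S Kstar t0) -/K0.
  have -> : K0 - Kstar = - (K1 - K0) + K1 - Kstar by rewrite opprB subrK.
  rewrite (le_trans (frobenius_normD _ _)) // frobenius_normN.
  rewrite (le_trans (lerD (frobenius_normD _ _) (lexx _))) // frobenius_normN -/f.
  have K1b := le_trans (Kcoer _ K1st) (lerD (lexx 1) (ler_wpM2l c0 J1)).
  have s3 : 1 <= s ^+ 3 by rewrite exprn_ege1.
  have s23 : s ^+ 2 <= s ^+ 3 by rewrite ler_weXn2l.
  rewrite /M; set u := frobenius_norm Kstar.
  have u0 : 0 <= u by exact: frobenius_norm_ge0.
  have h1 : 0 <= (1 + c * J Kstar + u) * (s ^+ 3 - 1).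
    by rewrite mulr_ge0 ?subr_ge0 // !addr_ge0 ?mulr_ge0.
  have h2 : 0 <= (c * g) * (s ^+ 3 - s ^+ 2) by rewrite mulr_ge0 ?subr_ge0 ?mulr_ge0.
  by lra.
rewrite exprS mulrA ler_pM2r ?exprn_gt0 // /s mulrDr mulr1 mulrC divfK ?gt_eqF //.
by rewrite gerDl leNgt b0.
Qed.
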